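(* Let $G$ be an infinite abelian group. Then the following statements are equivalent: (1) $G$ admits a $T$-sequence $\mathbf{u}=\{u_n\}$ such that the topological group $(G,\mathbf{u})$ is almost maximally almost-periodic. (2) $G$ has a non-trivial finite subgroup.
   Context: Abelian groups are written additively. A sequence $\mathbf{u}=\{u_n\}$ of elements of an abelian group $G$ is called a $T$-sequence if there is a Hausdorff group topology on $G$ for which $u_n$ converges to zero. For a $T$-sequence $\mathbf{u}$ in $G$, $(G,\mathbf{u})$ denotes the group $G$ equipped with the finest group topology in which $u_n$ converges to zero (this topology is Hausdorff). For a topological abelian group $X$, $\widehat{X}$ denotes the group of all continuous characters of $X$, i.e. continuous homomorphisms from $X$ to the circle group $\mathbb{T}$. The von Neumann radical of $X$ is $\mathbf{n}(X)=\bigcap_{\chi\in\widehat{X}}\ker\chi$. A Hausdorff topological abelian group $X$ is called almost maximally almost-periodic if $\mathbf{n}(X)$ is non-trivial and finite. *)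

(* Defs.v *)
From HB Require Import structures.
From mathcomp Require Import all_boot all_order all_algebra.
From mathcomp Require Import all_classical all_reals all_analysis.
From mathcomp Require Import complex.

Set Implicit Arguments.
Unset Strict Implicit.
Unset Printing Implicit Defensive.

Import Order.TTheory GRing.Theory Num.Theory.
Import numFieldNormedType.Exports.

Local Open Scope classical_set_scope.
Local Open Scope ring_scope.

(* The library ties a topology to a type through canonical structures. Since
   several topologies on the same group have to be compared, a group topology
   on G is given here by its family of open sets; [gt_space t] is a copy of G
   carrying [t], on which the notions of the library (convergence, continuity,
   [hausdorff_space]) are used. *)
Record group_topology (G : zmodType) := GroupTopology {
  gt_open : set_system G ;
  gt_openT : gt_open setT ;
  gt_openI : setI_closed gt_open ;
  gt_open_bigU : forall (I : Type) (f : I -> set G),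
    (forall i, gt_open (f i)) -> gt_open (\bigcup_i f i) ;
  gt_sub_continuous : forall (x y : G) (A : set G), gt_open A -> A (x - y) ->
    exists B C : set G, [/\ gt_open B, gt_open C, B x, C y &
      forall b c, B b -> C c -> A (b - c)] }.

Definition gt_space (G : zmodType) (t : group_topology G) : Type := G.

Section GtSpace.
Variables (G : zmodType) (t : group_topology G).

HB.instance Definition _ := GRing.Zmodule.on (gt_space t).
HB.instance Definition _ := isOpenTopological.Build (gt_space t)
  (gt_openT t) (gt_openI (g := t)) (gt_open_bigU (g := t)).

Let sub_continuous :
  continuous (fun x : gt_space t * gt_space t => x.1 - x.2).
Proof.
move=> [x y] A [U [oU Uxy UA]].
have [B [C [oB oC Bx Cy BCU]]] := gt_sub_continuous oU Uxy.
exists (B, C); first by split; apply: open_nbhs_nbhs.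
by move=> [b c] [/= Bb Cc]; apply/UA/BCU.
Qed.

HB.instance Definition _ :=
  PreTopologicalNmodule_isTopologicalZmodule.Build (gt_space t) sub_continuous.

End GtSpace.

Definition converges_to_0 (G : zmodType) (t : group_topology G) (u : nat -> G) :=
  (u : nat -> gt_space t) @ \oo --> (0 : gt_space t).

Definition T_sequence (G : zmodType) (u : nat -> G) :=
  exists t : group_topology G,
    hausdorff_space (gt_space t) /\ converges_to_0 t u.

(* The finest group topology in which u converges to 0: the supremum of all
   group topologies in which u converges to 0. *)
Section Finest.
Variables (G : zmodType) (u : nat -> G).

Let I := {t : group_topology G | converges_to_0 t u}.
Let Tc (i : I) : Topological G := Topological.class (gt_space (sval i)).
Let S := sup_topology Tc.

Let finest_sub (x y : G) (A : set G) : @open S A -> A (x - y) ->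
  exists B C : set G, [/\ @open S B, @open S C, B x, C y &
    forall b c, B b -> C c -> A (b - c)].
Proof.
move=> oA Axy.
have cvS : (fun p : S * S => ((p.1 : G) - (p.2 : G) : S)) @ nbhs ((x, y) : S * S)
           --> ((x - y : G) : S).
  apply/cvg_sup => i U /= /(@sub_continuous (gt_space (sval i)) (x, y)).
  have sub_nbhs (z : G) : nbhs (z : S) `=>` nbhs (z : gt_space (sval i)).
    by have /cvg_sup := @cvg_id _ (nbhs (z : S)); exact.
  move=> [[B C] [/= Bx Cy] BCU]; exists (B, C) => //=.
  by split; apply: sub_nbhs.
have [[B C] [/= Bx Cy] BCA] := cvS A (open_nbhs_nbhs (conj oA Axy)).
move: Bx Cy; rewrite !nbhsE => -[B' [oB' B'x] B'B] [C' [oC' C'y] C'C].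
exists B', C'; split=> // b c B'b C'c.
by apply: (BCA (b, c)); split; [exact: B'B | exact: C'C].
Qed.

Definition finest_group_topology : group_topology G :=
  @GroupTopology G (@open S) openT (@openI S)
    (fun J f fo => @bigcup_open S J setT f (fun i _ => fo i)) finest_sub.

Lemma finest_converges_to_0 : converges_to_0 finest_group_topology u.
Proof.
have cvS : (u : nat -> S) @ \oo --> ((0 : G) : S).
  by apply/cvg_sup => i; exact: (svalP i).
move=> A [U [oU U0 UA]]; apply: filterS UA _.
by apply: cvS; exact: open_nbhs_nbhs.
Qed.

Lemma finest_group_topology_finest (t : group_topology G) :
  converges_to_0 t u -> gt_open t `<=` gt_open finest_group_topology.
Proof.
move=> tu A oA; pose i : I := exist _ t tu.
rewrite /= openE => x Ax.
have /cvg_sup/(_ i) := @cvg_id _ (nbhs (x : S)); apply.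
by apply: (@open_nbhs_nbhs (gt_space t)).
Qed.

End Finest.

(* (G, u) *)
Notation finest_space u := (gt_space (finest_group_topology u)).

(* The circle group is the unit circle of the complex numbers R[i] with
   multiplication; R[i]^o carries the topology of the modulus. *)
Definition continuous_character (R : realType) (X : topologicalZmodType)
    (chi : X -> R[i]^o) :=
  [/\ forall x, `|chi x| = 1,
      forall x y, chi (x + y) = chi x * chi y
    & continuous chi].

Definition von_neumann_radical (R : realType) (X : topologicalZmodType) : set X :=
  \bigcap_(chi in @continuous_character R X) [set x | chi x = 1].
Arguments von_neumann_radical : clear implicits.

Definition almost_maximally_almost_periodic (R : realType)
    (X : topologicalZmodType) :=
  [/\ hausdorff_space X,
      von_neumann_radical R X <> [set 0]
    & finite_set (von_neumann_radical R X)].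

(* Main.v *)
Require Import Defs.
From HB Require Import structures.
From mathcomp Require Import all_boot all_order all_algebra.
From mathcomp Require Import all_classical all_reals all_analysis.
From mathcomp Require Import complex.
From mathcomp Require Import ring lra zify.

Set Implicit Arguments.
Unset Strict Implicit.
Unset Printing Implicit Defensive.

Import Order.TTheory GRing.Theory Num.Theory.
Import numFieldNormedType.Exports.

Local Open Scope classical_set_scope.
Local Open Scope ring_scope.

(** Let u be a sequence in G and X the group G with the finest group topology
    in which u converges to 0. A homomorphism chi from G to the circle is
    continuous on X exactly when chi (u n) tends to 1
    ([continuous_character_finest]), so the radical of X is the common kernel
    of these chi. It is a subgroup, which gives the easy implication.

    For the converse, one looks for u whose radical is the cyclic group
    generated by a torsion element e. The sequence alternates between terms b n
    and terms c n - e, where c n is a long sum of terms of b with indices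
    tending to infinity. Three things are needed ([almost_map_criterion]).
    - When chi (b n) tends to 1, so does chi (c n); then chi (c n - e) -> 1
      forces chi e = 1, and e lies in the radical.
    - The characters with chi e = 1 and chi (b n) -> 1 separate the points
      outside the multiples of e, so that the radical is not larger.
    - X is Hausdorff: making c n - e small must not make a nonzero multiple of
      e small. This holds because c n is so long that it stays far from 0 in
      any topology that only knows that b converges to 0. The distance is
      measured by seminorms D n that are bounded along b uniformly in n, vanish
      at e, and are at least n + 1 at the multiples m (c n) with |m| <= n, except for
      those m that kill both c n and e.

    An infinite group G with a nonzero torsion element contains one of three
    configurations on which such b, c and D exist.
    - Infinitely many elements of prime order ([almost_map_infinite_socle]):
      they contain a free family, b lists the multiples of its members, c n is
      a sum of n + 1 of them and D n counts coordinates.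
    - An element x of infinite order ([almost_map_infinite_order]):
      b i = 2 ^ i x.
    - Otherwise G is torsion with finite socle, and a compactness argument
      yields a Pruefer subgroup ([exists_prufer], [almost_map_prufer]): b is its
      standard sequence of generators.
    In the last two cases characters of G take on b the values
    exp (2 i pi / p ^ k), where k is a difference of indices, and D n is a sum
    of distances |chi_l - 1| over a long arithmetic progression of levels l
    ([almost_map_ladder]).

    Everything takes place on G itself: seminorms are built from subgroups or
    from characters of G, and characters defined on subgroups extend to G
    because the circle is divisible ([partial_char_extend]). *)

(** * The finest topology and filtrations *)

(** A countable neighbourhood basis of 0 for a group topology. Asking only for
    differences makes symmetry and sums come for free, two levels deeper. *)
Definition filtration (G : zmodType) (U : nat -> set G) :=
  (forall k, U k 0) /\ (forall k x y, U k.+1 x -> U k.+1 y -> U k (x - y)).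

Section Filtration.
Variables (G : zmodType) (U : nat -> set G).
Hypothesis filtU : filtration U.

Let U0 k : U k 0. Proof. by case: filtU => U0 _; exact: U0. Qed.

Let UB k x y : U k.+1 x -> U k.+1 y -> U k (x - y).
Proof. by case: filtU => _; exact. Qed.

Let U_succ k x : U k.+1 x -> U k x.
Proof. by move=> Ux; rewrite -[x]subr0; apply: UB. Qed.

Let U_le k l x : (k <= l)%N -> U l x -> U k x.
Proof.
move=> /subnK <-; elim: (l - k)%N => // n IH.
by rewrite addSn => /U_succ/IH.
Qed.

Let UD k x y : U k.+2 x -> U k.+2 y -> U k (x + y).
Proof.
move=> Ux Uy; rewrite -[y]opprK; apply: UB; first exact: U_succ.
by rewrite -[- y]sub0r; apply: UB.
Qed.

Definition filtration_open : set_system G :=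
  [set A | forall x, A x -> exists k, forall y, U k y -> A (x + y)].

Let openT : filtration_open setT. Proof. by move=> x _; exists 0%N. Qed.

Let openI : setI_closed filtration_open.
Proof.
move=> A B oA oB x [/oA[k kA] /oB[l lB]]; exists (maxn k l) => y Uy; split.
  by apply: kA; apply: U_le Uy; rewrite leq_maxl.
by apply: lB; apply: U_le Uy; rewrite leq_maxr.
Qed.

Let open_bigU (I : Type) (f : I -> set G) :
  (forall i, filtration_open (f i)) -> filtration_open (\bigcup_i f i).
Proof.
move=> of_ x [i _ /of_[k kf]]; exists k => y /kf fy; by exists i.
Qed.

(** The interior of the translate of [U k] by [x]. *)
Definition filtration_ball k (x : G) : set G :=
  [set z | exists l, forall y, U l y -> U k (z + y - x)].

Let ball_open k x : filtration_open (filtration_ball k x).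
Proof.
move=> z [l lU]; exists l.+2 => y Uy; exists l.+2 => w Uw.
by rewrite -(addrA z); apply: lU; apply: UD.
Qed.

Let ball_center k x : filtration_ball k x x.
Proof. by exists k => y Uy; rewrite addrAC subrr add0r. Qed.

Let ball_sub k x z : filtration_ball k x z -> U k (z - x).
Proof. by case=> l /(_ _ (U0 l)); rewrite addr0. Qed.

Let sub_continuous (x y : G) (A : set G) : filtration_open A -> A (x - y) ->
  exists B C : set G, [/\ filtration_open B, filtration_open C, B x, C y &
    forall b c, B b -> C c -> A (b - c)].
Proof.
move=> oA /oA[k kA]; exists (filtration_ball k.+1 x), (filtration_ball k.+1 y).
split=> // b c /ball_sub Ub /ball_sub Uc.
have /kA := UB Ub Uc; congr A.
by rewrite opprB addrC addrACA subrK addrAC subrr add0r.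
Qed.

Definition filtration_topology : group_topology G :=
  @GroupTopology G filtration_open openT openI open_bigU sub_continuous.

Lemma nbhs_filtration (x : G) :
  nbhs (x : gt_space filtration_topology) [set y | U 0 (y - x)].
Proof.
rewrite nbhsE; exists (filtration_ball 0 x); last by move=> z /ball_sub.
by split; [exact: ball_open|exact: ball_center].
Qed.

Lemma filtration_converges (u : nat -> G) :
  (forall k, \forall n \near \oo, U k (u n)) ->
  converges_to_0 filtration_topology u.
Proof.
move=> uU A; rewrite nbhsE => -[W [oW W0] WA].
have [k kW] := oW _ W0.
apply: (filterS _ (uU k)) => n Un /=.
by apply: WA; rewrite -[u n](@add0r G); exact: kW.
Qed.

End Filtration.

(** The topology of a filtration that u eventually enters at every level is
    coarser than the finest one. *)
Lemma nbhs_finest (G : zmodType) (u : nat -> G) (U : nat -> set G) (x : G) :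
  filtration U -> (forall k, \forall n \near \oo, U k (u n)) ->
  nbhs (x : finest_space u) [set y | U 0 (y - x)].
Proof.
move=> filtU uU; have := nbhs_filtration filtU x.
rewrite nbhsE => -[W [oW Wx] WU].
rewrite nbhsE; exists W => //; split=> //.
by have := finest_group_topology_finest (filtration_converges (filtU := filtU) uU) oW.
Qed.

(** The separating filtration may depend on the point: the finest topology
    refines all of them at once. *)
Lemma hausdorff_finest (G : zmodType) (u : nat -> G) :
  (forall g, g != 0 -> exists U, [/\ filtration U,
     forall k, \forall n \near \oo, U k (u n) & ~ U 0 g]) ->
  hausdorff_space (finest_space u).
Proof.
move=> sep p q pq; apply/eqP; apply/negPn/negP => npq.
have /sep[U [filtU uU nU]] : (q : G) - p != 0.
  by rewrite subr_eq0 eq_sym.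
(* Two points of [U 1] differ by a point of [U 0]. *)
have filtV : filtration (fun k => U k.+1).
  by case: filtU => U0 UB; split=> k *; [exact: U0|exact: UB].
have uV k : \forall n \near \oo, U k.+1 (u n) by exact: uU.
have [z [zp zq]] := pq _ _ (@nbhs_finest G u _ p filtV uV)
  (@nbhs_finest G u _ q filtV uV).
apply: nU; case: filtU => _ /(_ _ _ _ zp zq).
by rewrite opprB addrC -addrA addrA; congr (U _ _); rewrite -addrA addKr.
Qed.

(** * Distances on the unit circle *)

Section CircleDistance.
Variable R : realType.
Implicit Types z w : R[i].

Definition dist1 z : R := Normc.normc (z - 1).

Lemma dist1E z : (dist1 z)%:C%C = `|z - 1|.
Proof. by rewrite /dist1; case: (z - 1) => a b; rewrite normc_def. Qed.

Lemma dist1_1 : dist1 1 = 0.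
Proof. by rewrite /dist1 subrr Normc.normc0. Qed.

Lemma dist1_ge0 z : 0 <= dist1 z.
Proof. by rewrite -lecR dist1E rmorph0 normr_ge0. Qed.

Lemma dist1_eq0 z : dist1 z = 0 -> z = 1.
Proof. by move/Normc.eq0_normc/eqP; rewrite subr_eq0 => /eqP. Qed.

Lemma dist1M z w : `|z| = 1 -> dist1 (z * w) <= dist1 z + dist1 w.
Proof.
move=> z1; rewrite -lecR rmorphD /= !dist1E.
have -> : z * w - 1 = (z - 1) + z * (w - 1) by ring.
by rewrite (le_trans (ler_normD _ _))// normrM z1 mul1r.
Qed.

Lemma dist1V z : `|z| = 1 -> dist1 z^-1 = dist1 z.
Proof.
move=> z1; apply: complexI; rewrite !dist1E.
have z0 : z != 0 by rewrite -normr_eq0 z1 oner_eq0.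
have -> : z^-1 - 1 = - (z^-1 * (z - 1)) by field.
by rewrite normrN normrM normfV z1 invr1 mul1r.
Qed.

Lemma unit_neq0 z : `|z| = 1 -> z != 0.
Proof. by move=> z1; rewrite -normr_eq0 z1 oner_eq0. Qed.

Lemma unit_exprz z (k : int) : `|z| = 1 -> `|z ^ k| = 1.
Proof.
by move=> z1; case: k => n; rewrite ?NegzE -?exprnN ?normfV normrX z1 expr1n ?invr1.
Qed.

Lemma dist1_div z w : `|z| = 1 -> `|w| = 1 -> dist1 (z / w) <= dist1 z + dist1 w.
Proof. by move=> z1 w1; rewrite -[dist1 w]dist1V//; exact: dist1M. Qed.

Lemma dist1X z n : `|z| = 1 -> dist1 (z ^+ n) <= dist1 z *+ n.
Proof.
move=> z1; elim: n => [|n IH]; first by rewrite expr0 dist1_1 mulr0n.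
by rewrite exprS mulrS (le_trans (dist1M _ _))// lerD2l.
Qed.

Lemma dist1_prod I (r : seq I) (P : pred I) (F : I -> R[i]) :
  (forall i, `|F i| = 1) ->
  dist1 (\prod_(i <- r | P i) F i) <= \sum_(i <- r | P i) dist1 (F i).
Proof.
move=> F1; elim: r => [|i r IH]; first by rewrite !big_nil dist1_1.
rewrite !big_cons; case: ifP => // _.
by rewrite (le_trans (dist1M _ _))// lerD2l.
Qed.

(** Near 1 the map z |-> z ^ p multiplies the distance to 1 by nearly p:
    z ^ p - 1 = (z - 1)(1 + z + ... + z ^ (p - 1)), and the second factor is
    close to p. The factor 3 / 2 is what survives for every p >= 2. *)
Lemma dist1_expand p z : (1 < p)%N -> `|z| = 1 ->
  dist1 z * (p ^ 2)%:R <= 2^-1 -> 3 / 2 * dist1 z <= dist1 (z ^+ p).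
Proof.
move=> p1 z1 small.
have sum_near : `|\sum_(i < p) z ^+ i - p%:R| <= (dist1 z * (p ^ 2)%:R)%:C%C.
  rewrite -[p in p%:R]card_ord -sum1_card natr_sum -sumrB.
  rewrite (le_trans (ler_norm_sum _ _ _))//.
  rewrite (@le_trans _ _ (\sum_(i < p) (dist1 z *+ p)%:C%C))//.
    apply: ler_sum => i _; rewrite -dist1E lecR (le_trans (dist1X _ _))//.
    by rewrite ler_wpMn2l// ?dist1_ge0// ltnW.
  rewrite sumr_const card_ord -rmorphMn /= lecR -mulrnA.
  by rewrite -mulnn -[X in X <= _]mulr_natr.
have sum_big : (3 / 2 : R)%:C%C <= `|\sum_(i < p) z ^+ i|.
  have : (p%:R : R[i]) <= `|\sum_(i < p) z ^+ i| + (2^-1 : R)%:C%C.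
    have -> : (p%:R : R[i]) = `|p%:R| by rewrite normr_nat.
    have -> : (p%:R : R[i]) = \sum_(i < p) z ^+ i
      - (\sum_(i < p) z ^+ i - p%:R) by ring.
    rewrite (le_trans (ler_normB _ _))// lerD2l (le_trans sum_near)//.
    by rewrite lecR.
  rewrite -lerBlDr => /(le_trans _); apply.
  have -> : (p%:R : R[i]) = (p%:R : R)%:C%C by rewrite rmorph_nat.
  rewrite -rmorphB lecR.
  have : (2 : R) <= p%:R by rewrite ler_nat.
  lra.
rewrite -lecR rmorphM /= !dist1E subrX1 normrM mulrC.
by rewrite ler_wpM2l.
Qed.

End CircleDistance.

(** * Characters and their extension *)

Definition character (R : realType) (G : zmodType) (chi : G -> R[i]) :=
  (forall x, `|chi x| = 1) /\ (forall x y, chi (x + y) = chi x * chi y).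

Section CharacterTheory.
Variables (R : realType) (G : zmodType) (chi : G -> R[i]).
Hypothesis chiP : character chi.

Lemma char_norm x : `|chi x| = 1. Proof. by case: chiP. Qed.

Lemma charD x y : chi (x + y) = chi x * chi y. Proof. by case: chiP. Qed.

Lemma char_neq0 x : chi x != 0. Proof. exact/unit_neq0/char_norm. Qed.

Lemma char0 : chi 0 = 1.
Proof. by apply: (mulfI (char_neq0 0)); rewrite -charD addr0 mulr1. Qed.

Lemma charN x : chi (- x) = (chi x)^-1.
Proof.
by apply: (mulfI (char_neq0 x)); rewrite -charD subrr char0 divff// char_neq0.
Qed.

Lemma charB x y : chi (x - y) = chi x / chi y.
Proof. by rewrite charD charN. Qed.

Lemma charMn x n : chi (x *+ n) = chi x ^+ n.
Proof.
by elim: n => [|n IH]; rewrite ?mulr0n ?char0// mulrS charD IH exprS.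
Qed.

Lemma charMz x (k : int) : chi (x *~ k) = chi x ^ k.
Proof. by case: k => n; rewrite ?charMn// NegzE mulrNz charN charMn. Qed.

Lemma char_sum I (r : seq I) (P : pred I) (F : I -> G) :
  chi (\sum_(i <- r | P i) F i) = \prod_(i <- r | P i) chi (F i).
Proof. exact: (big_morph chi charD char0). Qed.

Lemma dist1_charB x y : dist1 (chi (x - y)) <= dist1 (chi x) + dist1 (chi y).
Proof. by rewrite charB dist1_div// char_norm. Qed.

End CharacterTheory.

(** A homomorphism from a subgroup of G to the circle, encoded by its graph. *)
Definition partial_character (R : realType) (G : zmodType)
    (Gam : set (G * R[i])) :=
  [/\ Gam (0, 1),
      forall x y z w, Gam (x, z) -> Gam (y, w) -> Gam (x - y, z / w),
      forall x z, Gam (x, z) -> `|z| = 1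
    & forall z, Gam (0, z) -> z = 1].

(** Subgroups of the integers are principal: d is the least positive element. *)
Lemma int_subgroup (K : set int) :
  K 0 -> (forall k l, K k -> K l -> K (k - l)) ->
  (forall k, K k -> k = 0) \/
  exists2 d : nat, (0 < d)%N /\ K d & forall k, K k -> (d %| k)%Z.
Proof.
move=> K0 KB.
have KN k : K k -> K (- k) by rewrite -[- k]sub0r; exact: KB.
have KD k l : K k -> K l -> K (k + l).
  by move=> Kk Kl; rewrite -[l]opprK; apply: KB => //; exact: KN.
have KM k l : K k -> K (k * l).
  move=> Kk; have KMn n : K (k * n%:Z).
    elim: n => [|n IH]; first by rewrite mulr0.
    by rewrite intS mulrDr mulr1; exact: KD.
  by case: l => n //; rewrite NegzE mulrN; apply: KN; exact: KMn.
have [|nz] := pselect (forall k, K k -> k = 0); first by left.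
right; have ex_pos : exists n : nat, `[< (0 < n)%N /\ K n >].
  move/existsNP: nz => [k /not_implyP[Kk k0]]; exists `|k|%N; apply/asboolP.
  split; first by rewrite absz_gt0; exact/eqP.
  by have := KN _ Kk; case: k Kk {k0} => n.
have := ex_minnP ex_pos; case=> d /asboolP[d0 Kd] dmin; exists d => // k Kk.
apply/dvdz_mod0P.
have rE : (k %% d)%Z = k - d%:Z * (k %/ d)%Z by rewrite /modz mulrC.
have Kr : K (k %% d)%Z by rewrite rE; apply: KB => //; exact: KM.
have dn0 : d%:Z != 0 by rewrite eqz_nat -lt0n.
have dp : 0 < d%:Z by rewrite ltz_nat.
move: (modz_ge0 k dn0) (ltz_pmod k dp) Kr.
case: (k %% d)%Z => // r _; rewrite ltz_nat => rd Kr.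
have [->//|r0] := posnP r.
have : (d <= r)%N by apply: dmin; apply/asboolP.
by rewrite leqNgt rd.
Qed.

Section Extension.
Variables (R : realType) (G : zmodType).
Implicit Types (Gam : set (G * R[i])) (g x y : G) (z w : R[i]).

Lemma partial_charV Gam x z : partial_character Gam -> Gam (x, z) ->
  Gam (- x, z^-1).
Proof.
by move=> [G0 GB _ _] Gx; have := GB _ _ _ _ G0 Gx; rewrite sub0r div1r.
Qed.

Lemma partial_charM Gam x y z w : partial_character Gam ->
  Gam (x, z) -> Gam (y, w) -> Gam (x + y, z * w).
Proof.
move=> pG Gx /(partial_charV pG) Gy; case: pG => _ GB _ _.
by have := GB _ _ _ _ Gx Gy; rewrite opprK invrK.
Qed.

Lemma partial_charX Gam x z (k : int) : partial_character Gam ->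
  Gam (x, z) -> Gam (x *~ k, z ^ k).
Proof.
move=> pG Gx; have GX n : Gam (x *+ n, z ^+ n).
  elim: n => [|n IH]; first by case: pG.
  by rewrite mulrS exprS; exact: partial_charM.
case: k => n; first exact: GX.
by rewrite NegzE mulrNz -exprnN; apply: partial_charV => //; exact: GX.
Qed.

Lemma partial_char_inj Gam x z w : partial_character Gam ->
  Gam (x, z) -> Gam (x, w) -> z = w.
Proof.
move=> [_ GB G1 G0] Gz Gw.
have /G0/divr1_eq// : Gam (0, z / w) by rewrite -(subrr x); exact: GB.
Qed.

(** The homomorphism extending [Gam] that sends [g] to [z]. *)
Definition adjoin Gam g z : set (G * R[i]) :=
  [set q | exists x w (k : int), Gam (x, w) /\ q = (x + g *~ k, w * z ^ k)].

Lemma sub_adjoin Gam g z : Gam `<=` adjoin Gam g z.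
Proof.
by move=> [x w] Gx; exists x, w, 0; rewrite mulr0z addr0 expr0z mulr1.
Qed.

Lemma adjoin_gen Gam g z : partial_character Gam -> adjoin Gam g z (g, z).
Proof. by case=> G0 _ _ _; exists 0, 1, 1; rewrite add0r mul1r. Qed.

Lemma adjoin_partial_char Gam g z : partial_character Gam -> `|z| = 1 ->
  (forall k w, Gam (g *~ k, w) -> w = z ^ k) ->
  partial_character (adjoin Gam g z).
Proof.
move=> pG z1 zP; have z0 := unit_neq0 z1; split.
- by apply: sub_adjoin; case: pG.
- move=> _ _ _ _ [x [u [k [Gx [-> ->]]]]] [y [v [l [Gy [-> ->]]]]].
  exists (x - y), (u / v), (k - l); split; first by case: pG => _ GB _ _; exact: GB.
  rewrite mulrzBr opprD addrACA; congr (_, _).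
  by rewrite expfzDr// -invr_expz invfM mulrACA.
- move=> _ _ [x [u [k [Gx [_ ->]]]]]; case: pG => _ _ G1 _.
  by rewrite normrM (G1 _ _ Gx) unit_exprz// mulr1.
- move=> w [x [u [k [Gx [/esym/eqP]]]]].
  rewrite addr_eq0 => /eqP xE ->; have := partial_charV pG Gx.
  rewrite xE opprK => /zP uE; rewrite -uE mulfV// unit_neq0//.
  by case: pG => _ _ G1 _; exact: G1 Gx.
Qed.

(** The circle is divisible: if d is the order of g modulo the domain of Gam, a
    d-th root of the value prescribed at d g is a possible value at g. *)
Lemma adjoin_exists Gam g : partial_character Gam ->
  exists2 z, `|z| = 1 & forall k w, Gam (g *~ k, w) -> w = z ^ k.
Proof.
move=> pG; have := pG => -[G0 GB G1 GU].
have [| |Kz|[d [d0 [w0 Gd]] dP]] :=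
    @int_subgroup [set k | exists w, Gam (g *~ k, w)].
- by exists 1; rewrite mulr0z.
- move=> k l [w Gw] [v Gv]; exists (w / v); rewrite mulrzBr.
  exact: GB.
- exists 1; first exact: normr1.
  move=> k w Gw; have k0 := Kz k (ex_intro _ w Gw).
  by move: Gw; rewrite k0 mulr0z expr0z => /GU.
- have rootK : (d.-root w0) ^+ d = w0 by exact: rootCK.
  exists (d.-root w0).
    apply/eqP; rewrite -(@pexpr_eq1 _ _ d)// -normrX rootK.
    by apply/eqP; exact: G1 Gd.
  move=> k w Gw; have /dvdzP[q kE] := dP k (ex_intro _ w Gw).
  apply: (partial_char_inj pG Gw); rewrite kE mulrC.
  by rewrite mulrzA -exprz_exp -exprnP rootK; exact: partial_charX.
Qed.

(** Zorn's lemma is applied to the sets [X] to be added to [Gam], rather than to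
    the extensions of [Gam], so that the empty chain needs no special case. *)
Lemma partial_char_extend Gam : partial_character Gam ->
  exists2 chi : G -> R[i], character chi & forall x z, Gam (x, z) -> chi x = z.
Proof.
move=> pG; pose P := [set X | partial_character (Gam `|` X)].
have [|A [PA Amax]] := @Zorn_bigcup _ P.
  move=> F FP Ftot.
  have pair q q' : (Gam `|` \bigcup_(X in F) X) q ->
      (Gam `|` \bigcup_(X in F) X) q' ->
      (Gam q /\ Gam q') \/
      exists2 X, F X & (Gam `|` X) q /\ (Gam `|` X) q'.
    case=> [Gq|[X FX Xq]] [Gq'|[Y FY Yq']].
    - by left.
    - by right; exists Y => //; split; [left|right].
    - by right; exists X => //; split; [right|left].
    - right; have [XY|YX] := Ftot _ _ FX FY.
        by exists Y => //; split; right => //; exact: XY.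
      by exists X => //; split; right => //; exact: YX.
  have sub X : F X -> Gam `|` X `<=` Gam `|` \bigcup_(Y in F) Y.
    by move=> FX q [|Xq]; [left|right; exists X].
  split.
  - by left; case: pG.
  - move=> x y z w Ux Uy; have [[Gx Gy]|[X FX [Xx Xy]]] := pair _ _ Ux Uy.
      by left; case: pG => _ GB _ _; exact: GB.
    by apply: (sub _ FX); have [_ GB _ _] := FP _ FX; exact: GB.
  - move=> x z [Gx|[X FX Xx]]; first by case: pG => _ _ G1 _; exact: G1 Gx.
    by have [_ _ G1 _] := FP _ FX; apply: (G1 x); right.
  - move=> z [Gx|[X FX Xx]]; first by case: pG => _ _ _ GU; exact: GU.
    by have [_ _ _ GU] := FP _ FX; apply: GU; right.
pose M := Gam `|` A.
have tot g : exists z, M (g, z).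
  have [z z1 zP] := adjoin_exists g PA; exists z.
  have pM := adjoin_partial_char PA z1 zP.
  apply: contrapT => nM; apply: (Amax (adjoin M g z)).
    split; first by move=> q Aq; apply: sub_adjoin; right.
    by move/(_ (g, z) (adjoin_gen g z PA)) => ?; apply: nM; right.
  rewrite /P /=; suff -> : Gam `|` adjoin M g z = adjoin M g z by [].
  by apply/setUidPr => q Gq; apply: sub_adjoin; left.
have [chi chiM] := choice tot; exists chi.
  split=> x; first by case: PA => _ _ G1 _; exact: G1 (chiM x).
  by move=> y; apply: (partial_char_inj PA (chiM _));
    exact: (partial_charM PA (chiM x) (chiM y)).
by move=> x z Gx; apply: (partial_char_inj PA (chiM x)); left.
Qed.

End Extension.

(** * The exponential map and separation of points *)

Section CircleExponential.
Variable R : realType.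
Implicit Types (t a : R) (k : int).

Definition cis t : R[i] := (cos (2 * pi * t) +i* sin (2 * pi * t))%C.

Lemma cis_norm t : `|cis t| = 1.
Proof. by rewrite normc_def /= cos2Dsin2 sqrtr1. Qed.

Lemma cisD t a : cis (t + a) = cis t * cis a.
Proof.
rewrite /cis mulrDr cosD sinD; apply/eqP; rewrite eq_complex /=.
by apply/andP; split; apply/eqP; ring.
Qed.

Lemma cis0 : cis 0 = 1.
Proof. by rewrite /cis mulr0 cos0 sin0. Qed.

Lemma cisN t : cis (- t) = (cis t)^-1.
Proof.
have c0 : cis t != 0 by apply/unit_neq0/cis_norm.
by apply: (mulfI c0); rewrite -cisD subrr cis0 mulfV.
Qed.

Lemma cisMn t n : cis (t *+ n) = cis t ^+ n.
Proof.
by elim: n => [|n IH]; rewrite ?mulr0n ?cis0// mulrS cisD IH exprS.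
Qed.

Lemma cisMz t k : cis (t *~ k) = cis t ^ k.
Proof. by case: k => n; rewrite ?cisMn// NegzE mulrNz cisN cisMn. Qed.

Lemma cis_int k : cis k%:~R = 1.
Proof.
rewrite cisMz; suff -> : cis 1 = 1 by rewrite exp1rz.
by rewrite /cis mulr1 mulr_natl cos2pi sin2pi.
Qed.

Lemma cisDint t k : cis (t + k%:~R) = cis t.
Proof. by rewrite cisD cis_int mulr1. Qed.

Lemma cis_sum I (r : seq I) (F : I -> R) :
  cis (\sum_(i <- r) F i) = \prod_(i <- r) cis (F i).
Proof. exact: (big_morph cis cisD cis0). Qed.

Lemma dist1_cis t : dist1 (cis t) = 2 * `|sin (pi * t)|.
Proof.
apply: (@pexpIrn _ 2) => //; rewrite ?nnegrE ?dist1_ge0 ?mulr_ge0//.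
rewrite exprMn real_normK ?num_real//.
have -> : dist1 (cis t) ^+ 2 = 2 - 2 * cos (2 * pi * t).
  rewrite /dist1 /= sqr_sqrtr ?addr_ge0 ?sqr_ge0//.
  by have := cos2Dsin2 (2 * pi * t); rewrite oppr0 addr0; lra.
have -> : 2 * pi * t = (pi * t) *+ 2 by rewrite -mulr_natr; ring.
by rewrite cos_mulr2n cos2sin2 -mulr_natl; ring.
Qed.

Lemma abs_sin_le t : `|sin t| <= `|t|.
Proof.
wlog t0 : t / 0 <= t.
  move=> H; have [/H//|/ltW t0] := leP 0 t.
  by rewrite -normrN -sinN -[leRHS]normrN; apply: H; rewrite oppr_ge0.
have [c _] := @MVT_segment R (@sin R) (@cos R) 0 t t0
  (fun x _ => is_derive_sin x) (continuous_subspaceT (@continuous_sin R)).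
rewrite sin0 !subr0 => ->; rewrite normrM ler_piMl//; exact: cos_max.
Qed.

Lemma dist1_cis_le t : dist1 (cis t) <= 2 * pi * `|t|.
Proof.
rewrite dist1_cis -mulrA ler_wpM2l// (le_trans (abs_sin_le _))//.
by rewrite normrM (ger0_norm (pi_ge0 R)).
Qed.

Lemma dist1_cis_gt0 t : 0 < t < 1 -> 0 < dist1 (cis t).
Proof.
move=> /andP[t0 t1]; rewrite dist1_cis mulr_gt0// normr_gt0 gt_eqF//.
by apply: sin_gt0_pi; rewrite mulr_gt0 ?pi_gt0//= gtr_pMr ?pi_gt0.
Qed.

Lemma dist1_cis_mono a t : 0 <= a -> a <= `|t| <= 2^-1 ->
  dist1 (cis a) <= dist1 (cis t).
Proof.
move=> a0 /andP[aLt t2]; have p0 := pi_gt0 R.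
have dom (x : R) : 0 <= x <= 2^-1 -> pi * x \in `[(- (pi / 2)), (pi / 2)].
  move=> /andP[x0 x2]; rewrite in_itv /=; apply/andP; split.
    have px : 0 <= pi * x by rewrite mulr_ge0 ?pi_ge0.
    by apply: le_trans px; rewrite oppr_le0 divr_ge0 ?pi_ge0.
  by rewrite ler_pM2l.
have sinabs (x : R) : 0 <= x <= 2^-1 -> `|sin (pi * x)| = sin (pi * x).
  move=> /andP[x0 x2]; apply: ger0_norm; apply: sin_ge0_pi.
  rewrite mulr_ge0 ?pi_ge0//= ger_pMr// (le_trans x2)//; lra.
have aux : dist1 (cis t) = dist1 (cis `|t|).
  by have [t0|t0] := ger0P t; rewrite // cisN dist1V// cis_norm.
have da : 0 <= a <= 2^-1 by rewrite a0 (le_trans aLt).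
have dt : 0 <= `|t| <= 2^-1 by rewrite normr_ge0.
rewrite aux !dist1_cis !sinabs// ler_wpM2l//.
by rewrite leNgt ltr_sin ?dom// -leNgt ler_pM2l.
Qed.

(** Reduce k modulo N: a remainder r with 0 < r < N gives a nontrivial root of
    unity. *)
Lemma cis_eq1_dvd (N : nat) k : (0 < N)%N -> cis (k%:~R / N%:R) = 1 -> (N %| k)%Z.
Proof.
move=> N0 c1; apply/dvdz_mod0P; set r := (k %% N)%Z.
have N0' : N%:R != 0 :> R by rewrite pnatr_eq0 -lt0n.
have : cis (r%:~R / N%:R) = 1.
  rewrite -(cisDint _ (k %/ N)%Z) -[RHS]c1; congr cis.
  have -> : k%:~R = (k %/ N)%Z%:~R * N%:R + r%:~R :> R.
    by rewrite [in LHS](divz_eq k N) rmorphD rmorphM.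
  by field.
have r0 : 0 <= r by rewrite modz_ge0// eqz_nat -lt0n.
have rN : r < N by rewrite ltz_pmod.
case: (ltgtP 0 r) r0 => // rp _ cr; exfalso.
suff : 0 < dist1 (cis (r%:~R / N%:R)) by rewrite cr dist1_1 ltxx.
apply: dist1_cis_gt0; rewrite divr_gt0 ?ltr0z ?ltr0n//=.
by rewrite ltr_pdivrMr ?ltr0n// mul1r -(ltr_int R) in rN *.
Qed.

End CircleExponential.

Definition subgroup (G : zmodType) (K : set G) :=
  K 0 /\ forall x y, K x -> K y -> K (x - y).

Lemma subgroupN (G : zmodType) (K : set G) x : subgroup K -> K x -> K (- x).
Proof. by move=> [K0 KB] Kx; rewrite -[- x]sub0r; exact: KB. Qed.

Lemma subgroupD (G : zmodType) (K : set G) x y :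
  subgroup K -> K x -> K y -> K (x + y).
Proof.
by move=> sK Kx Ky; rewrite -[y]opprK; apply: sK.2 => //; exact: subgroupN.
Qed.

Lemma subgroupMz (G : zmodType) (K : set G) x (k : int) :
  subgroup K -> K x -> K (x *~ k).
Proof.
move=> sK Kx; have KMn n : K (x *+ n).
  by elim: n => [|n IH]; [case: sK|rewrite mulrS; exact: subgroupD].
by case: k => n; [exact: KMn|rewrite NegzE mulrNz; apply: subgroupN => //; exact: KMn].
Qed.

Lemma subgroup_sum (G : zmodType) (K : set G) I (r : seq I) (P : pred I)
    (F : I -> G) :
  subgroup K -> (forall i, P i -> K (F i)) -> K (\sum_(i <- r | P i) F i).
Proof.
move=> sK KF; elim/big_ind: _ => //; first by case: sK.
by move=> x y; exact: subgroupD.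
Qed.

(** The points of G / K are separated by its characters: send g to -1 if it has
    infinite order modulo K, and to a primitive root of unity otherwise. *)
Lemma character_separates (R : realType) (G : zmodType) (K : set G) (g : G) :
  subgroup K -> ~ K g ->
  exists chi : G -> R[i],
    [/\ character chi, forall x, K x -> chi x = 1 & chi g != 1].
Proof.
move=> sK Kg; pose Gam : set (G * R[i]) := [set q | K q.1 /\ q.2 = 1].
have pG : partial_character Gam.
  split=> [|x y z w [/= Kx ->] [/= Ky ->]|x z [/= _ ->]|z [/= _ ->]] //.
  - by split=> //; case: sK.
  - by split=> /=; [exact: sK.2|rewrite divr1].
  - exact: normr1.
suff [z [z1 zn1 zP]] : exists z : R[i], [/\ `|z| = 1, z != 1 &
    forall k, K (g *~ k) -> z ^ k = 1].
  have zG k w : Gam (g *~ k, w) -> w = z ^ k by case=> /= /zP -> ->.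
  have [chi chiP chiE] := partial_char_extend (adjoin_partial_char pG z1 zG).
  exists chi; split=> //.
    by move=> x Kx; apply: chiE; apply: sub_adjoin.
  by rewrite (chiE _ _ (adjoin_gen g z pG)).
have cis_neq1 (n : nat) : (1 < n)%N -> cis (n%:R^-1 : R) != 1.
  move=> n1; apply/negP => /eqP c1.
  have n01 : 0 < (n%:R^-1 : R) < 1.
    by rewrite invr_gt0 ltr0n (ltnW n1) invf_lt1 ?ltr0n ?ltr1n ?(ltnW n1).
  by have := dist1_cis_gt0 n01; rewrite c1 dist1_1 ltxx.
have [| |K0|[d [d0 Kd] dP]] := @int_subgroup [set k | K (g *~ k)].
- by rewrite /= mulr0z; case: sK.
- by move=> k l /= Kk Kl; rewrite mulrzBr; exact: sK.2.
- exists (cis 2^-1); split; [exact: cis_norm|exact: cis_neq1|].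
  by move=> k /K0 ->; rewrite expr0z.
- exists (cis d%:R^-1); split; [exact: cis_norm| |].
    apply: cis_neq1; case: d d0 Kd {dP} => [//|[|//]] _ /=.
    by rewrite mulr1z => /Kg.
  move=> k /dP/dvdzP[q ->]; rewrite -cisMz -mulrzl mulrC -mulrzl intrM.
  by rewrite -(cis_int R q); congr cis; field; rewrite pnatr_eq0 -lt0n.
Qed.

(** * Continuous characters of the finest topology *)

Section CharactersOfFinest.
Variables (R : realType) (G : zmodType) (u : nat -> G).
Implicit Types chi : G -> R[i].

(** Halving the radius at each level pays for the two terms of a difference. *)
Definition char_filtration chi (eps : R) (k : nat) : set G :=
  [set x | dist1 (chi x) < eps / 2 ^+ k].

Lemma filtration_char chi eps : character chi -> 0 < eps ->
  filtration (char_filtration chi eps).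
Proof.
move=> chiP eps0; split=> [k|k x y]; rewrite /char_filtration /=.
  by rewrite (char0 chiP) dist1_1 divr_gt0// exprn_gt0.
move=> Ux Uy; rewrite (le_lt_trans (dist1_charB chiP _ _))//.
have -> : eps / 2 ^+ k = eps / 2 ^+ k.+1 + eps / 2 ^+ k.+1.
  by rewrite exprS; field; rewrite expf_neq0.
exact: ltrD.
Qed.

Lemma char_filtration_cvg chi eps k : 0 < eps ->
  dist1 (chi (u n)) @[n --> \oo] --> 0 ->
  \forall n \near \oo, char_filtration chi eps k (u n).
Proof.
move=> eps0 /cvgr0Pnorm_lt chiu.
have : 0 < eps / 2 ^+ k by rewrite divr_gt0// exprn_gt0.
move=> /chiu; apply: filterS => n /=.
by rewrite ger0_norm ?dist1_ge0.
Qed.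

(** The filtration of [chi] makes [chi] continuous, and if chi (u n) -> 1 then it
    is coarser than the finest topology. *)
Lemma continuous_character_finest chi :
  @continuous_character R (finest_space u) chi <->
  character chi /\ dist1 (chi (u n)) @[n --> \oo] --> 0.
Proof.
split=> [[chi1 chiD chiC]|[chiP chiu]].
  have chiP : character chi by [].
  split=> //; apply/cvgr0Pnorm_lt => eps eps0.
  have : ((fun n => chi (u n)) : nat -> R[i]^o) @ \oo --> (chi 0 : R[i]^o).
    by move=> A /(chiC 0); exact: (@finest_converges_to_0 G u).
  move=> /(@cvgrPdist_lt R[i] R[i]^o)/(_ eps%:C%C); rewrite ltcR => /(_ eps0).
  apply: filterS => n; rewrite (char0 chiP) distrC -dist1E ltcR.
  by rewrite ger0_norm ?dist1_ge0.
case: (chiP) => chi1 chiD; split=> // x.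
apply/(@cvgrPdist_lt R[i] R[i]^o _ _ (nbhs_filter (x : finest_space u))).
move=> eps eps0.
have [Re0 epsE] : 0 < complex.Re eps /\ eps = (complex.Re eps)%:C%C.
  by move: eps0; rewrite ltcE /= => /andP[/eqP]; case: eps => a b /= ->.
have := @nbhs_finest G u _ x (filtration_char chiP Re0)
  (fun k => char_filtration_cvg k Re0 chiu).
apply: filterS => y; rewrite /char_filtration /= expr0 divr1 => yx.
have -> : chi y = chi x * chi ((y : G) - x).
  by rewrite -(charD chiP) addrC subrK.
by rewrite -[X in X - _]mulr1 -mulrBr normrM chi1 mul1r distrC -dist1E epsE ltcR.
Qed.

End CharactersOfFinest.

Lemma torsion_mulrz (G : zmodType) (e : G) (N : nat) (j : int) : (0 < N)%N ->
  e *+ N = 0 -> exists2 i : nat, (i < N)%N & e *~ j = e *+ i.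
Proof.
move=> N0 eN; exists `|(j %% N)%Z|%N.
  by rewrite -ltz_nat gez0_abs ?modz_ge0 ?ltz_pmod// eqz_nat -lt0n.
rewrite pmulrn gez0_abs ?modz_ge0 ?eqz_nat -?lt0n// {1}(divz_eq j N).
by rewrite mulrzDr -mulrzA_C -pmulrn eN mul0rz add0r.
Qed.

(** Points outside the multiples of [e] are separated from 0 by characters, so
    only the multiples of [e] need a special filtration. *)
Lemma almost_map_of_generator (R : realType) (G : zmodType) (u : nat -> G)
    (e : G) (N : nat) :
  e != 0 -> (0 < N)%N -> e *+ N = 0 ->
  (forall j : int, e *~ j != 0 -> exists U, [/\ filtration U,
     forall k, \forall n \near \oo, U k (u n) & ~ U 0 (e *~ j)]) ->
  (forall chi : G -> R[i], character chi ->
     dist1 (chi (u n)) @[n --> \oo] --> 0 -> chi e = 1) ->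
  (forall g, (forall j : int, g <> e *~ j) -> exists chi : G -> R[i],
     [/\ character chi, dist1 (chi (u n)) @[n --> \oo] --> 0 & chi g != 1]) ->
  T_sequence u /\ almost_maximally_almost_periodic R (finest_space u).
Proof.
move=> e0 N0 eN sepe kill sep.
have hd : hausdorff_space (finest_space u).
  apply: hausdorff_finest => g g0.
  have [[j gE]|ng] := pselect (exists j : int, g = e *~ j).
    by rewrite gE; apply: sepe; rewrite -gE.
  have [j gj|chi [chiP chiu chig]] := sep g; first by apply: ng; exists j.
  have nu0 : 0 < dist1 (chi g).
    rewrite lt_neqAle dist1_ge0 andbT eq_sym.
    by apply/eqP => /dist1_eq0; exact/eqP.
  exists (char_filtration chi (dist1 (chi g))); split.
  - exact: filtration_char.
  - by move=> k; exact: char_filtration_cvg.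
  - by rewrite /char_filtration /= expr0 divr1 ltxx.
have rad_e : von_neumann_radical R (finest_space u) e.
  move=> chi /= /(continuous_character_finest u chi)[chiP chiu].
  exact: kill.
have rad_sub : von_neumann_radical R (finest_space u) `<=`
    [set e *+ i | i in `I_N].
  move=> g radg; have [[j ->]|ng] := pselect (exists j : int, (g : G) = e *~ j).
    by have [i iN ->] := torsion_mulrz j N0 eN; exists i.
  have [j gj|chi [chiP chiu /eqP[]]] := sep g; first by apply: ng; exists j.
  by apply: radg; apply/continuous_character_finest.
split.
  by exists (finest_group_topology u); split=> //; exact: finest_converges_to_0.
split=> //.
  by move=> rad0; move: rad_e; rewrite rad0 => /eqP; apply/negP.
by apply: sub_finite_set rad_sub _; apply: finite_image; exact: finite_II.
Qed.

(** * A criterion for the radical to be generated by one element *)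

Definition seminorm (R : realType) (G : zmodType) (D : G -> R) :=
  D 0 = 0 /\ forall x y, D (x - y) <= D x + D y.

Section Seminorm.
Variables (R : realType) (G : zmodType) (D : G -> R).
Hypothesis sD : seminorm D.

Lemma seminormB x y : D (x - y) <= D x + D y. Proof. by case: sD. Qed.

Lemma seminorm_ge0 x : 0 <= D x.
Proof. by have := seminormB x x; rewrite subrr (sD.1); lra. Qed.

Lemma seminorm_kernel : subgroup [set x | D x = 0].
Proof.
split=> [|x y /= Dx Dy]; first by case: sD.
by apply/eqP; rewrite eq_le seminorm_ge0 (le_trans (seminormB _ _))// Dx Dy addr0.
Qed.

End Seminorm.

Section Interleave.
Variable G : zmodType.

Definition interleave (b c : nat -> G) (n : nat) :=
  if odd n then c n./2 else b n./2.

Lemma near_interleave (b c : nat -> G) (P : set G) :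
  (\forall n \near \oo, P (interleave b c n)) <->
  (\forall n \near \oo, P (b n)) /\ (\forall n \near \oo, P (c n)).
Proof.
split=> [[N _ NP]|[[N1 _ NP1] [N2 _ NP2]]].
  split; exists N => // n /= Nn.
    have := NP n.*2; rewrite /interleave odd_double doubleK; apply.
    by rewrite /= (leq_trans Nn)// -addnn leq_addr.
  have := NP n.*2.+1; rewrite /interleave /= odd_double uphalf_double; apply.
  by rewrite /= (leq_trans Nn)// -addnn -addnS leq_addr.
exists (N1 + N2)%N.*2 => // n /= Nn; rewrite /interleave.
have {}Nn : (N1 + N2 <= n./2)%N by rewrite -(doubleK (N1 + N2)%N) half_leq.
case: odd; [apply: NP2|apply: NP1]; apply: leq_trans Nn.
  exact: leq_addl.
exact: leq_addr.
Qed.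

Lemma dist1_interleave (R : realType) (chi : G -> R[i]) (b c : nat -> G) :
  dist1 (chi (interleave b c n)) @[n --> \oo] --> 0 <->
  dist1 (chi (b n)) @[n --> \oo] --> 0 /\ dist1 (chi (c n)) @[n --> \oo] --> 0.
Proof.
split=> [bc0|[b0 c0]].
  split; apply/cvgr0Pnorm_lt => eps eps0.
    by move/cvgr0Pnorm_lt: bc0 => /(_ eps eps0)/(@near_interleave b c
      [set x | `|dist1 (chi x)| < eps])[].
  by move/cvgr0Pnorm_lt: bc0 => /(_ eps eps0)/(@near_interleave b c
    [set x | `|dist1 (chi x)| < eps])[].
apply/cvgr0Pnorm_lt => eps eps0.
apply/(@near_interleave b c [set x | `|dist1 (chi x)| < eps]).
by split; [move/cvgr0Pnorm_lt: b0|move/cvgr0Pnorm_lt: c0]; exact.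
Qed.

End Interleave.

Lemma near_forall_lt (P : nat -> nat -> Prop) N :
  (forall n, \forall i \near \oo, P n i) ->
  \forall i \near \oo, forall n, (n < N)%N -> P n i.
Proof.
move=> HP; elim: N => [|N IH]; first by exists 0%N.
apply: filterS2 IH (HP N) => i IHi PN n.
by rewrite ltnS leq_eqVlt => /orP[/eqP ->|/IHi].
Qed.

Lemma ex_extremal (B : set nat) N : B !=set0 -> (forall n, B n -> (n < N)%N) ->
  (exists2 n, B n & forall k, B k -> (n <= k)%N) /\
  (exists2 n, B n & forall k, B k -> (k <= n)%N).
Proof.
move=> [n0 Bn0] BN.
have exB : exists n, `[< B n >] by exists n0; apply/asboolP.
have ubB n : `[< B n >] -> (n <= N)%N by move/asboolP/BN/ltnW.
split.
  have [n /asboolP Bn nP] := ex_minnP exB.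
  by exists n => // k Bk; apply: nP; apply/asboolP.
have [n /asboolP Bn nP] := ex_maxnP exB ubB.
by exists n => // k Bk; apply: nP; apply/asboolP.
Qed.

Lemma sum_vanish (V : nmodType) (F : nat -> V) N N' : (N <= N')%N ->
  (forall i, (N <= i)%N -> F i = 0) -> \sum_(i < N') F i = \sum_(i < N) F i.
Proof.
move=> NN' F0; rewrite -!(big_mkord xpredT F) (big_cat_nat _ NN')//=.
rewrite -[RHS]addr0; congr (_ + _).
by rewrite big_nat_cond big1// => i; rewrite andbT => /andP[Ni _]; exact: F0.
Qed.

Section Criterion.
Variables (R : realType) (G : zmodType) (e : G) (b c : nat -> G).
Variables (D : nat -> G -> R) (E : G -> R) (C delta : R).
Hypothesis sD : forall n, seminorm (D n).
Hypothesis sE : seminorm E.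
(* The D n detect the c n, and E the multiples of e, which the D n do not see. *)
Hypothesis D_bounded : forall n i, D n (b i) <= C.
Hypothesis D_cvg : forall n, D n (b i) @[i --> \oo] --> 0.
Hypothesis E_cvg : E (b i) @[i --> \oo] --> 0.
Hypothesis delta_gt0 : 0 < delta.
Hypothesis E_sep : forall j : int, E (e *~ j) < delta -> e *~ j = 0.
Hypothesis D_e : forall n, D n e = 0.
Hypothesis D_c : forall n (m : int), (`|m| <= n)%N ->
  (e *~ m = 0 /\ c n *~ m = 0) \/ n.+1%:R <= D n (c n *~ m).
Hypothesis D_triangular :
  (forall n k, (n < k)%N -> D n (c k) = 0) \/
  (forall n k, (k < n)%N -> D n (c k) = 0).

Let comb (N : nat) (m : nat -> int) := \sum_(i < N) (c i - e) *~ m i.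

Let weight (N : nat) (m : nat -> int) : R := \sum_(i < N) `|m i|%:R / i.+1%:R.

(** The ball of radius 2 ^- k for the quotient pseudonorm in which the relations
    c i - e ~ 0 cost 1 / (i + 1) per use, and what remains is measured by all
    the D n (with scale n + 1) and by E. *)
Definition relation_filtration (k : nat) : set G :=
  [set x | exists N m, [/\ forall i, (N <= i)%N -> m i = 0,
     weight N m < 2 ^- k,
     forall n, D n (x - comb N m) < n.+1%:R * 2 ^- k &
     E (x - comb N m) < delta * 2 ^- k]].

Let comb_widen N N' m : (N <= N')%N -> (forall i, (N <= i)%N -> m i = 0) ->
  comb N' m = comb N m.
Proof.
move=> NN' m0; apply: (@sum_vanish G (fun i => (c i - e) *~ m i)) => // i Ni.
by rewrite m0.
Qed.

Let weight_widen N N' m : (N <= N')%N -> (forall i, (N <= i)%N -> m i = 0) ->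
  weight N' m = weight N m.
Proof.
move=> NN' m0; apply: (@sum_vanish R (fun i => `|m i|%:R / i.+1%:R)) => // i Ni.
by rewrite m0// mul0r.
Qed.

Let half k : 2 ^- k = 2 ^- k.+1 + 2 ^- k.+1 :> R.
Proof. by rewrite exprS; field; rewrite expf_neq0. Qed.

Let pow_gt0 k : 0 < 2 ^- k :> R.
Proof. by rewrite invr_gt0 exprn_gt0. Qed.

Lemma filtration_relation : filtration relation_filtration.
Proof.
split=> [k|k x y].
  exists 0%N, (fun=> 0); rewrite /weight /comb !big_ord0 subr0; split=> //.
    by move=> n; rewrite (sD n).1 mulr_gt0.
  by rewrite sE.1 mulr_gt0.
move=> [N1 [m1 [m10 w1 d1 e1]]] [N2 [m2 [m20 w2 d2 e2]]].
pose N := maxn N1 N2; pose m i := m1 i - m2 i.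
have [N1N N2N] : (N1 <= N)%N /\ (N2 <= N)%N by rewrite leq_maxl leq_maxr.
have combE : comb N m = comb N1 m1 - comb N2 m2.
  rewrite -(comb_widen N1N m10) -(comb_widen N2N m20) -sumrB.
  by apply: eq_bigr => i _; rewrite mulrzBr.
have xyE : x - y - comb N m = (x - comb N1 m1) - (y - comb N2 m2).
  by rewrite combE !opprB addrACA [RHS]addrACA; congr (_ + _); rewrite addrC.
exists N, m; split.
- move=> i Ni.
  by rewrite /m (m10 i (leq_trans N1N Ni)) (m20 i (leq_trans N2N Ni)) subr0.
- rewrite half (le_lt_trans _ (ltrD w1 w2))//.
  rewrite -(weight_widen N1N m10) -(weight_widen N2N m20) -big_split /=.
  apply: ler_sum => i _; rewrite -mulrDl ler_wpM2r ?invr_ge0//.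
  by rewrite -natrD ler_nat /m; lia.
- move=> n; rewrite xyE (le_lt_trans (seminormB (sD n) _ _))//.
  by rewrite half mulrDr ltrD.
- rewrite xyE (le_lt_trans (seminormB sE _ _))//.
  by rewrite half mulrDr ltrD.
Qed.

(** The bound C takes care of all large n at once; finitely many n remain. *)
Lemma relation_filtration_b k :
  \forall i \near \oo, relation_filtration k (b i).
Proof.
have [M MC] : exists M : nat, C < M%:R * 2 ^- k.
  exists (Num.trunc (C * 2 ^+ k)).+1.
  rewrite ltr_pdivlMr ?exprn_gt0//; exact: truncnS_gt.
have nearD : \forall i \near \oo, forall n, (n < M)%N ->
    D n (b i) < n.+1%:R * 2 ^- k.
  apply: (@near_forall_lt (fun n i => D n (b i) < n.+1%:R * 2 ^- k)) => n.
  have /cvgr0Pnorm_lt/(_ (n.+1%:R * 2 ^- k)) := @D_cvg n.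
  rewrite mulr_gt0// => /(_ isT); apply: filterS => i.
  by rewrite ger0_norm// seminorm_ge0.
have nearE : \forall i \near \oo, E (b i) < delta * 2 ^- k.
  have /cvgr0Pnorm_lt/(_ (delta * 2 ^- k)) := E_cvg.
  rewrite mulr_gt0// => /(_ isT); apply: filterS => i.
  by rewrite ger0_norm// seminorm_ge0.
apply: filterS2 nearD nearE => i Di Ei.
exists 0%N, (fun=> 0); rewrite /weight /comb !big_ord0 subr0; split=> // n.
have [/Di//|Mn] := ltnP n M.
rewrite (le_lt_trans (D_bounded _ _))// (lt_le_trans MC)//.
by rewrite ler_wpM2r ?(ltW (pow_gt0 k))// ler_nat ltnW.
Qed.

Lemma relation_filtration_c k :
  \forall i \near \oo, relation_filtration k (c i - e).
Proof.
exists (2 ^ k)%N => // i /= ki.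
exists i.+1, (fun j => (j == i)%:Z).
have combE : comb i.+1 (fun j => (j == i)%:Z) = c i - e.
  rewrite /comb big_ord_recr /= eqxx mulr1z big1 ?add0r// => j _.
  by rewrite ltn_eqF// mulr0z.
rewrite combE subrr; split.
- by move=> j ij; rewrite gtn_eqF.
- rewrite /weight big_ord_recr /= eqxx big1 ?add0r.
    rewrite mul1r ltf_pV2 ?posrE ?exprn_gt0//.
    by rewrite -natrX ltr_nat ltnS.
  by move=> j _; rewrite ltn_eqF// mul0r.
- by move=> n; rewrite (sD n).1 mulr_gt0.
- by rewrite sE.1 mulr_gt0.
Qed.

(** Suppose that e j is the sum of a small y and of m k (c k - e) over k. The
    cost gives |m k| <= k. If some term matters, take the first or the last
    index n for which it does, according to the shape of [D_triangular]: D n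
    sees only the term m n (c n), which is at least n + 1, whereas D n y is
    smaller. If no term matters, then e j = y is excluded by E. *)
Lemma relation_filtration_sep (j : int) :
  relation_filtration 0 (e *~ j) -> e *~ j = 0.
Proof.
move=> [N [m [m0 w1 Dy Ey]]]; apply: E_sep.
move: w1 Ey; rewrite expr0 invr1 mulr1 => w1 Ey.
have {}Dy n : D n (e *~ j - comb N m) < n.+1%:R.
  by have := Dy n; rewrite expr0 invr1 mulr1.
have m_small i : (`|m i| <= i)%N.
  have [iN|Ni] := ltnP i N; last by rewrite m0.
  rewrite -ltnS -(ltr_nat R) -[ltRHS]mul1r -ltr_pdivrMr//.
  apply: le_lt_trans w1; rewrite /weight (bigD1 (Ordinal iN))//= lerDl.
  by apply: sumr_ge0 => *; rewrite divr_ge0.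
pose B := [set n | ~ (e *~ m n = 0 /\ c n *~ m n = 0)].
have BN n : B n -> (n < N)%N.
  by move=> Bn; rewrite ltnNge; apply/negP => /m0 mn; apply: Bn; rewrite mn !mulr0z.
have [B0|/set0P/(ex_extremal)/(_ BN)[minB maxB]] := eqVneq B set0.
  move: Ey; rewrite /comb big1 ?subr0// => i _.
  have nB : ~ B i by rewrite B0.
  by have /contrapT[ei ci] := nB; rewrite mulrzBl ei ci subr0.
have [n Bn Bk] : exists2 n, B n & forall k, B k -> k != n -> D n (c k) = 0.
  case: D_triangular => Dt; [have [n Bn nP] := minB|have [n Bn nP] := maxB].
    exists n => // k /nP nk kn; apply: Dt.
    by rewrite ltn_neqAle nk andbT eq_sym.
  by exists n => // k /nP nk kn; apply: Dt; rewrite ltn_neqAle nk andbT.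
exfalso; have nN := BN _ Bn.
have [//|big] := D_c (m_small n).
have := lt_le_trans (Dy n) big; apply/negP; rewrite -leNgt.
have ker := seminorm_kernel (sD n).
have rest : D n (\sum_(k < N | k != Ordinal nN) c k *~ m k) = 0.
  apply: (subgroup_sum (K := [set x | D n x = 0])) => // k kn.
  have [Bk'|/contrapT[_ ->]] := pselect (B k); last exact: (sD n).1.
  by apply: subgroupMz => //; exact: Bk.
have eker (i : int) : D n (e *~ i) = 0 by apply: (subgroupMz i ker); exact: D_e.
set y := e *~ j - comb N m.
have -> : c n *~ m n = e *~ (j + \sum_(i < N) m i) -
    \sum_(k < N | k != Ordinal nN) c k *~ m k - y.
  rewrite /y /comb.
  under [\sum_(i < N) _ *~ _]eq_bigr do rewrite mulrzBl.
  rewrite sumrB mulrzDr mulrz_sumr.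
  rewrite [\sum_(i < N) c i *~ m i](bigD1 (Ordinal nN))//=.
  by rewrite opprB [RHS]addrC -!addrA !addKr subrr addr0.
rewrite (le_trans (seminormB (sD n) _ _))// gerDr.
by rewrite (le_trans (seminormB (sD n) _ _))// eker rest addr0.
Qed.

(** Given the Hausdorff property, the two remaining hypotheses say that e is in
    the radical and that the radical contains nothing but multiples of e. *)
Lemma almost_map_criterion (N : nat) :
  e != 0 -> (0 < N)%N -> e *+ N = 0 ->
  (forall chi : G -> R[i], character chi -> dist1 (chi (b i)) @[i --> \oo] --> 0 ->
     dist1 (chi (c i)) @[i --> \oo] --> 0) ->
  (forall g, (forall j : int, g <> e *~ j) -> exists chi : G -> R[i],
     [/\ character chi, chi e = 1, dist1 (chi (b i)) @[i --> \oo] --> 0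
       & chi g != 1]) ->
  exists u : nat -> G,
    T_sequence u /\ almost_maximally_almost_periodic R (finest_space u).
Proof.
move=> e0 N0 eN b_to_c sep; exists (interleave b (fun n => c n - e)).
apply: (almost_map_of_generator e0 N0 eN).
- move=> j ej0; exists relation_filtration; split.
  + exact: filtration_relation.
  + move=> k; apply/near_interleave; split; first exact: relation_filtration_b.
    exact: relation_filtration_c.
  + by move=> /relation_filtration_sep; exact/eqP.
- move=> chi chiP /dist1_interleave[bto /cvgr0Pnorm_lt ceto].
  have /cvgr0Pnorm_lt cto := b_to_c chi chiP bto.
  apply: dist1_eq0; apply/eqP; rewrite eq_le dist1_ge0 andbT leNgt.
  apply/negP => d0; have d20 : 0 < dist1 (chi e) / 2 by rewrite divr_gt0.
  have [n []] := filter_ex (filterI (cto _ d20) (ceto _ d20)).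
  rewrite /= !ger0_norm ?dist1_ge0// => cn cen.
  have := dist1_charB chiP (c n) (c n - e); rewrite opprB addrC subrK.
  lra.
- move=> g /sep[chi [chiP chie bto chig]]; exists chi; split=> //.
  apply/dist1_interleave; split=> //.
  under eq_fun do rewrite (charB chiP) chie divr1.
  exact: b_to_c.
Qed.

End Criterion.

(** * Seminorms, small subgroups of the circle and free families *)

(** The discrete seminorm of the quotient by a subgroup. *)
Lemma seminorm_outside (R : realType) (G : zmodType) (K : set G) :
  subgroup K -> seminorm (fun x => `[< ~ K x >]%:R : R).
Proof.
move=> sK; split=> [|x y].
  by rewrite asboolF//; apply; case: sK.
rewrite -natrD ler_nat; have [Kx|Kx] := pselect (K x); last first.
  by rewrite [`[< ~ K x >]]asboolT//; case: asbool.
have [Ky|Ky] := pselect (K y); last first.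
  by rewrite [`[< ~ K y >]]asboolT// addn1; case: asbool.
by rewrite asboolF//; apply; exact: sK.2.
Qed.

Lemma seminorm_sum (R : realType) (G : zmodType) I (r : seq I)
    (D : I -> G -> R) :
  (forall i, seminorm (D i)) -> seminorm (fun x => \sum_(i <- r) D i x).
Proof.
move=> sD; split=> [|x y]; first by apply: big1 => i _; case: (sD i).
by rewrite -big_split /=; apply: ler_sum => i _; exact: seminormB.
Qed.

Lemma geometric_bounded (R : realType) (a B : R) : 0 <= a ->
  (forall j, (3 / 2) ^+ j * a <= B) -> a = 0.
Proof.
move=> a0 aB; apply/eqP; rewrite eq_le a0 andbT leNgt; apply/negP => ap.
have lin j : 1 + j%:R / 2 <= (3 / 2 : R) ^+ j.
  elim: j => [|j IH]; first by rewrite expr0 mul0r addr0.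
  have := ler_wpM2l (ler0n R 3) IH; rewrite exprS -natr1 => H.
  have j0 : 0 <= j%:R :> R by [].
  nra.
have := aB (Num.trunc (2 * B / a)).+1.
apply/negP; rewrite -ltNge -ltr_pdivrMr//.
apply: lt_le_trans (lin _).
have := truncnS_gt (2 * B / a); rewrite -mulrA; lra.
Qed.

(** The circle has no small subgroups: repeated squaring drives every z <> 1 out
    of a fixed neighbourhood of 1. *)
Lemma no_small_subgroups (R : realType) (z : R[i]) : `|z| = 1 ->
  (forall j, dist1 (z ^+ (2 ^ j)) <= 8^-1) -> z = 1.
Proof.
move=> z1 small; apply: dist1_eq0; apply: (@geometric_bounded _ _ 8^-1).
  exact: dist1_ge0.
move=> j; apply: le_trans (small j).
elim: j => [|j IH]; first by rewrite expr0 mul1r expn0 expr1.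
rewrite exprS -mulrA (le_trans (ler_wpM2l _ IH))// ?divr_ge0//.
rewrite expnSr exprM; apply: dist1_expand => //; first by rewrite normrX z1 expr1n.
by have := small j; lra.
Qed.

Section Span.
Variable G : zmodType.
Implicit Types (e : nat -> G) (P : pred nat).

Definition span_of P e : set G := [set x | exists N (a : nat -> int),
  (forall i, ~~ P i || (N <= i)%N -> a i = 0) /\ x = \sum_(i < N) e i *~ a i].

Lemma span_of_widen P e x N0 : span_of P e x ->
  exists N (a : nat -> int), [/\ (N0 <= N)%N,
    forall i, ~~ P i || (N <= i)%N -> a i = 0 & x = \sum_(i < N) e i *~ a i].
Proof.
move=> [N [a [a0 xE]]]; exists (maxn N0 N), a; split; first exact: leq_maxl.
  move=> i; rewrite geq_max => /orP[Pi|/andP[_ Ni]]; apply: a0; first by rewrite Pi.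
  by rewrite Ni orbT.
rewrite xE (sum_vanish (F := fun i => e i *~ a i) (leq_maxr N0 N))// => i Ni.
by rewrite a0 ?Ni ?orbT.
Qed.

Lemma subgroup_span P e : subgroup (span_of P e).
Proof.
split=> [|x y /(span_of_widen 0)[N1 [a1 [_ a10 x1]]]].
  by exists 0%N, (fun=> 0); rewrite big_ord0.
move=> /(span_of_widen N1)[N2 [a2 [N12 a20 y2]]].
exists N2, (fun i => a1 i - a2 i); split=> [i iN|].
  rewrite a10 ?a20 ?subr0//; case/orP: iN => [->//|N2i].
  by rewrite (leq_trans N12 N2i) orbT.
rewrite x1 y2 -(sum_vanish (F := fun i => e i *~ a1 i) N12); last first.
  by move=> i Ni; rewrite a10 ?Ni ?orbT.
by rewrite -sumrB; apply: eq_bigr => i _; rewrite mulrzBr.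
Qed.

Lemma mem_span P e i : P i -> span_of P e (e i).
Proof.
move=> Pi; exists i.+1, (fun j => (j == i)%:Z); split=> [j|].
  by have [->|//] := eqVneq j i; rewrite Pi ltnn.
rewrite big_ord_recr /= eqxx mulr1z big1 ?add0r// => j _.
by rewrite ltn_eqF// mulr0z.
Qed.

Lemma torsion_dvd p (x : G) (a : int) : x *+ p = 0 ->
  (p %| a)%Z -> x *~ a = 0.
Proof.
by move=> xp /dvdzP[q ->]; rewrite -mulrzA_C -pmulrn xp mul0rz.
Qed.

(** A Bezout relation between p and a. *)
Lemma prime_order_gen p (x : G) (a : int) : prime p -> x *+ p = 0 ->
  ~~ (p %| a)%Z -> exists k : int, x = x *~ a *~ k.
Proof.
move=> pp xp pa; have : coprimez p a.
  by rewrite coprimezE prime_coprime.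
move=> /coprimezP[[u v] /= uv1]; exists v.
rewrite -[LHS](mulr1z x) -uv1 mulrzDr -mulrzA_C -pmulrn xp mul0rz add0r.
by rewrite -mulrzA mulrC.
Qed.

Variables (e : nat -> G) (p : nat -> nat).
Hypothesis p_prime : forall n, prime (p n).
Hypothesis e_p : forall n, e n *+ p n = 0.
Hypothesis e_free : forall n, ~ span_of (fun i => (i < n)%N) e (e n).

(** In a vanishing combination the last nonzero term would lie in the span of the
    previous ones. The orders p i may differ, so only the terms, and not the
    coefficients, are shown to vanish. *)
Lemma independent N (a : nat -> int) : \sum_(i < N) e i *~ a i = 0 ->
  forall i, (i < N)%N -> e i *~ a i = 0.
Proof.
elim: N => // N IH; rewrite big_ord_recr /=.
have [pa|pa] := boolP (p N %| a N)%Z.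
  rewrite (torsion_dvd (e_p N))// addr0 => /IH Hi i.
  rewrite ltnS leq_eqVlt => /orP[/eqP ->|/Hi//].
  exact: (torsion_dvd (e_p N)).
move=> /eqP; rewrite addr_eq0 => /eqP sumE; exfalso; apply: (@e_free N).
have [k ->] := prime_order_gen (p_prime N) (e_p N) pa.
have sS := subgroup_span (fun i => (i < N)%N) e.
apply: subgroupMz => //; rewrite -[_ *~ _]opprK -sumE.
apply: subgroupN => //; apply: subgroup_sum => // i _.
by apply: subgroupMz => //; exact: mem_span.
Qed.

Lemma span_free (P : pred nat) j (a : int) : ~~ P j ->
  span_of P e (e j *~ a) -> e j *~ a = 0.
Proof.
move=> Pj /(span_of_widen j.+1)[N [b [jN b0 eE]]].
pose d i := (i == j)%:Z * a - b i.
have sum0 : \sum_(i < N) e i *~ d i = 0.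
  under eq_bigr do rewrite mulrzBr.
  rewrite sumrB -eE (bigD1 (Ordinal jN))//= eqxx mul1r big1 ?addr0 ?subrr// => i.
  by rewrite -val_eqE /= => /negPf ->; rewrite mul0r mulr0z.
by have := independent sum0 jN; rewrite /d eqxx mul1r b0 ?Pj// subr0.
Qed.

End Span.

(** * Direct sums of groups of prime order *)

Section DirectSum.
Variables (R : realType) (G : zmodType) (e : nat -> G) (p : nat -> nat).
Hypothesis p_prime : forall n, prime (p n).
Hypothesis e_p : forall n, e n *+ p n = 0.
Hypothesis e_free : forall n, ~ span_of (fun i => (i < n)%N) e (e n).
Hypothesis p_const_or_large : (forall n, p n = p 0) \/ (forall n, (n < p n)%N).

Let free P j a := @span_free G e p p_prime e_p e_free P j a.

Let e_neq0 n : e n <> 0.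
Proof.
move=> en; apply: (@e_free n); rewrite en.
by case: (subgroup_span (fun i => (i < n)%N) e).
Qed.

(** All multiples of each e j with j > 0 are listed, and not only e j itself: if
    chi tends to 1 along them, then chi maps the whole group generated by e j
    near 1, hence chi (e j) = 1, for j large, even if the orders p j are
    unbounded. *)
Definition multiples (i : nat) : G :=
  if (pickle_inv i : option (nat * nat)) is Some (j, k) then
    if (k < p j.+1)%N then e j.+1 *+ k else 0
  else 0.

Lemma multiplesP i :
  multiples i = 0 \/ exists j k, (0 < j)%N /\ multiples i = e j *+ k.
Proof.
rewrite /multiples; case: pickle_inv => [[j k]|]; last by left.
by case: ifP => _; [right; exists j.+1, k|left].
Qed.

Lemma multiples_far J :
  \forall i \near \oo, span_of (fun j => (J <= j)%N) e (multiples i).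
Proof.
exists (\max_(j < J) \max_(k < p j.+1) (pickle (j : nat, k : nat)).+1)%N => //.
move=> i /= Mi; have sP := subgroup_span (fun j => (J <= j)%N) e.
rewrite /multiples; have := pickle_invK (T := (nat * nat)%type) i.
case: pickle_inv => [[j k] /= iE|_]; last by case: sP.
case: ifP => kp; last by case: sP.
rewrite pmulrn; apply: subgroupMz => //; apply: mem_span.
rewrite leqNgt; apply/negP => /ltnW jJ; move: Mi; apply/negP; rewrite -ltnNge.
pose F (j' : 'I_J) := \max_(k' < p j'.+1) (pickle (j' : nat, k' : nat)).+1.
have := leq_trans (leq_bigmax (Ordinal kp)) (leq_bigmax (F := F) (Ordinal jJ)).
by rewrite /= iE.
Qed.

Lemma multiples_all (P : set G) : (\forall i \near \oo, P (multiples i)) ->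
  \forall j \near \oo, forall k, P (e j *+ k).
Proof.
move=> [N _ NP].
exists (\max_(i < N) if (pickle_inv i : option (nat * nat)) is Some (j, k)
  then j.+2 else 0)%N.+1 => // -[//|j] /= Mj k.
have -> : e j.+1 *+ k = e j.+1 *+ (k %% p j.+1).
  by rewrite [in LHS](divn_eq k (p j.+1)) mulrnDr mulnC mulrnA e_p mul0rn add0r.
set k' := (k %% _)%N; have k'p : (k' < p j.+1)%N by rewrite ltn_pmod// prime_gt0.
have -> : e j.+1 *+ k' = multiples (pickle (j, k')).
  by rewrite /multiples pickleK_inv k'p.
apply: NP; rewrite /= leqNgt; apply/negP => iN; move: Mj; apply/negP.
pose F (i : 'I_N) := if (pickle_inv i : option (nat * nat)) is Some (j, k)
  then j.+2 else 0%N.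
have := leq_bigmax (F := F) (Ordinal iN); rewrite {1}/F /= pickleK_inv => FN.
by rewrite -ltnNge; exact: leqW FN.
Qed.

(** The intervals [(n+1)^2, (n+1)^2 + n] are disjoint and avoid 0. *)
Definition block_start n := (n.+1 ^ 2)%N.

Definition block_sum n : G := \sum_(t < n.+1) e (block_start n + t).

Definition others j : pred nat := fun i => i != j.

Definition block_support n (x : G) : R :=
  \sum_(t < n.+1) `[< ~ span_of (others (block_start n + t)) e x >]%:R.

Let block_disj n k t s : (t < n.+1)%N -> (s < k.+1)%N -> n != k ->
  (block_start n + t != block_start k + s)%N.
Proof. rewrite /block_start; nia. Qed.

Let sD n : seminorm (block_support n).
Proof. by apply: seminorm_sum => t; apply: seminorm_outside; exact: subgroup_span. Qed.

Let support0 n x :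
  (forall t, (t < n.+1)%N -> span_of (others (block_start n + t)) e x) ->
  block_support n x = 0.
Proof. by move=> xs; apply: big1 => t _; rewrite asboolF//; apply; exact: xs. Qed.

Let start_gt n t : (n < block_start n + t)%N.
Proof. rewrite /block_start; nia. Qed.

Let support_multiples n i : block_support n (multiples i) <= 1.
Proof.
have [->|[j [k [j0 ->]]]] := multiplesP i; first by rewrite (sD n).1.
have off t : j != (block_start n + t)%N ->
    span_of (others (block_start n + t)) e (e j *+ k).
  move=> jt; rewrite pmulrn; apply: subgroupMz; first exact: subgroup_span.
  exact: mem_span.
have [[t0 t0E]|nt] := pselect (exists t : 'I_n.+1, j = (block_start n + t)%N).
  rewrite /block_support (bigD1 t0)//= [X in _ + X]big1 ?addr0.
    by case: asbool.
  move=> t tt0; rewrite asboolF//; apply; apply: off; rewrite t0E eqn_add2l.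
  by rewrite eq_sym.
rewrite support0// => t tn; apply: off; apply/eqP => jE; apply: nt.
by exists (Ordinal tn).
Qed.

Let support_multiples_cvg n : block_support n (multiples i) @[i --> \oo] --> 0.
Proof.
apply/cvgr0Pnorm_lt => eps eps0.
apply: filterS (multiples_far (block_start n + n.+1)) => i Mi.
rewrite support0 ?normr0// => t tn.
have [N [a [a0 ->]]] := Mi.
apply: subgroup_sum; first exact: subgroup_span.
move=> j _; have [jt|jt] := eqVneq (j : nat) (block_start n + t)%N.
  rewrite a0 ?mulr0z; first by case: (subgroup_span (others (block_start n + t)) e).
  by rewrite jt leq_add2l -ltnNge tn.
by apply: subgroupMz; [exact: subgroup_span|exact: mem_span].
Qed.

(** If p j > |m| for every j in the block, m does not kill any coordinate of the
    block sum. If all orders are equal to p 0, either the same holds or m kills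
    the block sum and e 0 together. *)
Let support_block n (m : int) : (`|m| <= n)%N ->
  (e 0 *~ m = 0 /\ block_sum n *~ m = 0) \/
  n.+1%:R <= block_support n (block_sum n *~ m).
Proof.
move=> mn; have [->|m0] := eqVneq m 0; first by left; rewrite !mulr0z.
have [[pc pm]|pm] : ((forall n, p n = p 0) /\ (p 0 %| m)%Z) \/
    forall t, ~~ (p (block_start n + t) %| m)%Z.
  have [pc|pl] := p_const_or_large.
    have [pm|pm] := boolP (p 0 %| m)%Z; first by left.
    by right=> t; rewrite pc.
  right=> t; apply/negP; rewrite dvdzE /= => /dvdn_leq; rewrite absz_gt0 m0.
  move=> /(_ isT); apply/negP; rewrite -ltnNge (leq_ltn_trans mn)//.
  exact: ltn_trans (start_gt n t) (pl _).
  left; split; first exact: torsion_dvd (e_p 0) pm.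
  rewrite /block_sum mulrz_suml big1// => t _.
  by apply: (torsion_dvd (e_p _)); rewrite pc.
right; rewrite /block_support (eq_bigr (fun=> 1)).
  by rewrite sumr_const card_ord.
move=> t _; rewrite asboolT//; set l := (block_start n + t)%N => Nl.
have sN := subgroup_span (others l) e.
apply: (e_neq0 (n := l)).
have [k ->] := prime_order_gen (p_prime l) (e_p l) (pm t).
rewrite -mulrzA; apply: (free (P := others l)); first by rewrite /others negbK.
rewrite mulrzA; apply: subgroupMz => //.
have -> : e l *~ m = block_sum n *~ m -
    \sum_(s < n.+1 | s != t) e (block_start n + s) *~ m.
  by rewrite /block_sum mulrz_suml (bigD1 t)//= addrK.
apply: sN.2 => //; apply: subgroup_sum => // s st.
by apply: subgroupMz => //; apply: mem_span; rewrite /others eqn_add2l.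
Qed.

(** The sequence [multiples] starts at e 1, so that e 0 can be the generator of
    the radical. A point in all the subgroups generated by e 0 and the e i with
    i >= m is a multiple of e 0, by independence. *)
Lemma almost_map_direct_sum : exists u : nat -> G,
  T_sequence u /\ almost_maximally_almost_periodic R (finest_space u).
Proof.
have sP := subgroup_span (fun i => (0 < i)%N) e.
pose E (x : G) : R := `[< ~ span_of (fun i => (0 < i)%N) e x >]%:R.
apply: (@almost_map_criterion R G (e 0) multiples block_sum block_support E 1 1
  sD _ support_multiples support_multiples_cvg _ ltr01 _ _ support_block _ (p 0)).
- exact: seminorm_outside.
- rewrite (_ : (fun i => _) = fun=> 0); first exact: cvg_cst.
  apply/funext => i; rewrite /E asboolF//; apply.
  have [->|[j [k [j0 ->]]]] := multiplesP i; first by case: sP.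
  by rewrite pmulrn; apply: subgroupMz => //; exact: mem_span.
- move=> j; rewrite /E; case: asboolP; first by rewrite ltxx.
  by move=> /contrapT + _; apply: free.
- move=> n; apply: support0 => t tn; apply: mem_span.
  by rewrite /others eq_sym -lt0n (leq_ltn_trans _ (start_gt n t)).
- left=> n k nk; apply: support0 => t tn; apply: subgroup_sum.
    exact: subgroup_span.
  move=> s _; apply: mem_span; rewrite /others block_disj//.
  by rewrite gtn_eqF.
- exact/eqP/e_neq0.
- exact: prime_gt0.
- exact: e_p.
- move=> chi chiP chib; have /cvgr0Pnorm_lt/(_ 8^-1) := chib.
  rewrite invr_gt0 => /(_ (ltr0n _ 8)).
  move=> /(@multiples_all [set x | `|dist1 (chi x)| < 8^-1])[J _ JP].
  apply/cvgr0Pnorm_lt => eps eps0; exists J => // n /= Jn.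
  rewrite (char_sum chiP) big1 ?dist1_1 ?normr0// => t _.
  apply: no_small_subgroups => [|j]; first exact: char_norm.
  have := JP (block_start n + t)%N; rewrite /= => /(_ _ (2 ^ j)%N).
  rewrite (charMn chiP) ger0_norm ?dist1_ge0// => H; apply: ltW; apply: H.
  exact: leq_trans Jn (ltnW (start_gt n t)).
- move=> g ng.
  have [m gm] : exists m, ~ span_of (fun i => (i == 0) || (m <= i))%N e g.
    apply: contrapT => /forallNP H.
    have {H} H m : span_of (fun i => (i == 0) || (m <= i))%N e g.
      exact: contrapT (H m).
    have [N [a [a0 gE]]] := H 0%N.
    have [M [b [NM b0 gE']]] := span_of_widen N.+1 (H N).
    apply: (ng (b 0)).
    pose d i := a i - b i.
    have sum0 : \sum_(i < M) e i *~ d i = 0.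
      under eq_bigr do rewrite mulrzBr.
      rewrite sumrB -gE' gE.
      rewrite (sum_vanish (F := fun i => e i *~ a i) (ltnW NM)) ?subrr// => i Ni.
      by rewrite a0 ?Ni ?orbT.
    have M0 : (0 < M)%N by apply: leq_ltn_trans NM.
    have ind := independent p_prime e_p e_free sum0.
    rewrite gE' (bigD1 (Ordinal M0))//= big1 ?addr0// => i.
    rewrite -val_eqE /= => i0; have := ind i (ltn_ord i); rewrite /d mulrzBr.
    have [Ni|iN] := leqP N i.
      rewrite a0 ?Ni ?orbT// mulr0z sub0r => /eqP.
      by rewrite oppr_eq0 => /eqP.
    by rewrite (b0 i) ?mulr0z// negb_or i0 -ltnNge iN.
  set K := span_of _ e in gm.
  have sK : subgroup K by exact: subgroup_span.
  have [chi [chiP chiK chig]] := @character_separates R G K g sK gm.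
  exists chi; split=> //.
    by apply: chiK; apply: mem_span.
  apply/cvgr0Pnorm_lt => eps eps0.
  apply: filterS (multiples_far m) => i [N [a [a0 ->]]].
  rewrite chiK ?dist1_1 ?normr0//; exists N, a; split=> // j.
  rewrite negb_or => /orP[/andP[_ mj]|Nj]; apply: a0; first by rewrite mj.
  by rewrite Nj orbT.
Qed.

End DirectSum.

(** * Sums along geometric progressions *)

Lemma sum_inj_le (R : realType) (F : nat -> R) K (P : pred 'I_K)
    (t : 'I_K -> nat) lo hi :
  (forall i, 0 <= F i) -> {in P &, injective t} ->
  (forall a, P a -> (lo <= t a < hi)%N) ->
  \sum_(a | P a) F (t a) <= \sum_(lo <= i < hi) F i.
Proof.
move=> F0 tinj tlh.
have -> : \sum_(a | P a) F (t a) =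
    \sum_(lo <= i < hi) \sum_(a | P a) (i == t a)%:R * F i.
  rewrite exchange_big /=; apply: eq_bigr => a Pa.
  rewrite (big_rem (t a)) /=; last by rewrite mem_index_iota tlh.
  rewrite eqxx mul1r big1_seq ?addr0// => i; rewrite /= mem_rem_uniq ?iota_uniq//.
  by rewrite inE => /andP[/negPf -> _]; rewrite mul0r.
apply: ler_sum => i _; rewrite -mulr_suml ler_piMl// -natr_sum lern1.
have [[a Pa ia]|nt] := pselect (exists2 a, P a & i = t a).
  rewrite (bigD1 a)//= ia eqxx big1 ?addn0// => a' /andP[Pa' aa'].
  case: eqP => // /tinj H; move: aa'; rewrite H ?eqxx//; exact.
rewrite big1// => a Pa; case: eqP => // ia; case: nt; by exists a.
Qed.

Lemma sum_geometric_decay (R : realType) (a : nat -> R) lo hi :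
  (forall i, 0 <= a i) -> (forall i, (lo <= i)%N -> 3 / 2 * a i.+1 <= a i) ->
  \sum_(lo <= i < hi) a i <= 3 * a lo.
Proof.
move=> a0 decay; have [hl|lh] := leqP hi lo.
  by rewrite big_geq// mulr_ge0.
apply: (@le_trans _ _ (3 * (a lo - a hi))); last first.
  by rewrite ler_wpM2l// gerBl.
rewrite -opprB -(telescope_sumr _ (ltnW lh)) -sumrN mulr_sumr.
rewrite big_nat_cond [leRHS]big_nat_cond.
apply: ler_sum => i /andP[/andP[li _] _]; have := decay i li; lra.
Qed.

(** The distance of cis (p ^- k) to 1 is at most 2 pi 2 ^- k, so distinct positive
    exponents give a bounded sum, however many there are; exponent 0
    contributes nothing. *)
Lemma dist1_cis_sum (R : realType) (p K : nat) (t : 'I_K -> nat) : (1 < p)%N ->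
  {in [pred a | (0 < t a)%N] &, injective t} ->
  \sum_(a < K) dist1 (cis (p%:R ^- t a : R)) <= 6 * pi.
Proof.
move=> p_gt1 tinj; have pR_gt0 : 0 < p%:R :> R by rewrite ltr0n ltnW.
rewrite (bigID (fun a => 0 < t a)%N)/= [X in _ + X]big1 ?addr0; last first.
  move=> a; rewrite -eqn0Ngt => /eqP ->.
  by rewrite expr0 invr1 (cis_int R 1) dist1_1.
pose F (i : nat) : R := 2 * pi * 2 ^- i.
have F0 i : 0 <= F i by rewrite !mulr_ge0 ?pi_ge0 ?invr_ge0 ?exprn_ge0.
apply: (@le_trans _ _ (\sum_(a < K | (0 < t a)%N) F (t a))).
  apply: ler_sum => a _; rewrite (le_trans (dist1_cis_le _))//.
  rewrite ger0_norm ?invr_ge0 ?exprn_ge0//.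
  rewrite ler_wpM2l ?mulr_ge0 ?pi_ge0// lef_pV2 ?posrE ?exprn_gt0//.
  by rewrite lerXn2r ?nnegrE// ler_nat.
have [_ /(_ (1 + \max_a t a)%N)] : True /\ forall hi, \sum_(1 <= i < hi) F i <= 3 * F 1%N.
  split=> // hi; apply: sum_geometric_decay => // i _.
  rewrite /F exprS invfM; have : 0 <= 2 * pi * 2 ^- i :> R by exact: F0.
  lra.
have -> : 3 * F 1%N = 3 * pi by rewrite /F expr1; field.
move=> H; apply: (le_trans (sum_inj_le (lo := 1) (hi := (1 + \max_a t a)%N) F0 tinj _)).
  by move=> a; rewrite inE => ->; rewrite /= add1n ltnS leq_bigmax.
by apply: (le_trans H); rewrite ler_wpM2r ?pi_ge0// ler_nat.
Qed.

Section Block.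
Variables (R : realType) (G : zmodType) (K Q n : nat).
Variables (psi : nat -> G -> R[i]) (y : nat -> G).
Hypothesis Qn : (4 * n.+1 <= Q)%N.
Hypothesis psiP : forall a, character (psi a).
Hypothesis psi_y : forall a j, (a < K)%N -> (j < K)%N ->
  psi a (y j) = cis (Q%:R ^- (j.+1 - a)).

Let Q0 : 0 < Q%:R :> R.
Proof. by rewrite ltr0n; apply: leq_trans Qn; rewrite muln_gt0. Qed.

Let geo k : R := \sum_(i < k) Q%:R ^- i.+1.

Let geo_bounds k : Q%:R^-1 <= geo k.+1 <= 2 / Q%:R.
Proof.
have geoS i : geo i.+1 = Q%:R^-1 + geo i / Q%:R.
  rewrite /geo big_ord_recl expr1 mulr_suml; congr (_ + _).
  by apply: eq_bigr => j _; rewrite lift0 [in LHS]exprSr invfM.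
have geo0 i : 0 <= geo i by apply: sumr_ge0 => j _; rewrite invr_ge0 exprn_ge0.
apply/andP; split; first by rewrite geoS lerDl divr_ge0.
elim: k => [|k IH].
  rewrite geoS /geo big_ord0 mul0r addr0 ler_peMl ?invr_ge0//; lra.
rewrite geoS mulrDl mul1r lerD2l ler_pdivrMr// mulVf ?gt_eqF//.
apply: (le_trans IH); rewrite ler_pdivrMr// mul1r ler_nat.
by apply: leq_trans Qn; lia.
Qed.

(** psi a takes at the sum of the y j the value cis S, where, up to the integer
    contributed by the j < a, S = 1/Q + 1/Q^2 + ... lies between 1/Q and 2/Q. As
    4 n < Q, multiplying by m brings S neither closer to 0 than 1/Q nor beyond
    1/2, so each psi a contributes at least the distance of cis (1/Q) to 1. *)
Lemma block_lower_bound (m : int) : m != 0 -> (`|m| <= n)%N ->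
  dist1 (cis (Q%:R^-1)) *+ K <= \sum_(a < K) dist1 (psi a ((\sum_(j < K) y j) *~ m)).
Proof.
move=> m0 mn; rewrite -[X in _ *+ X]card_ord -sumr_const; apply: ler_sum => a _.
rewrite (charMz (psiP a)) (char_sum (psiP a)).
under eq_bigr do rewrite psi_y//.
rewrite -(cis_sum _ (fun j : 'I_K => Q%:R ^- (j.+1 - a))) -cisMz.
have -> : \sum_(j < K) (Q%:R ^- (j.+1 - a) : R) = geo (K - a) + a%:R.
  rewrite -(big_mkord xpredT (fun j => (Q%:R ^- (j.+1 - a) : R))).
  rewrite (big_cat_nat _ (ltnW (ltn_ord a)))//= addrC; congr (_ + _).
    rewrite -{1}[a : nat]add0n big_addn big_mkord; apply: eq_bigr => i _.
    by rewrite -addSn addnK.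
  rewrite big_nat_cond (eq_bigr (fun=> 1)).
    by rewrite -big_nat_cond sumr_const_nat subn0.
  move=> i /andP[/andP[_ ia] _]; have -> : (i.+1 - a = 0)%N by lia.
  by rewrite expr0 invr1.
have [k Ka] : exists k, (K - a = k.+1)%N.
  by exists (K - a).-1; have := ltn_ord a; lia.
rewrite Ka mulrzDl -[a%:R *~ m]mulrzr -[a%:R]/((a : int)%:~R) -intrM cisDint.
have /andP[geo_lo geo_hi] := geo_bounds k.
have geo0 : 0 <= geo k.+1 by apply: le_trans geo_lo; rewrite invr_ge0.
apply: dist1_cis_mono; first by rewrite invr_ge0.
rewrite -mulrzr normrM (ger0_norm geo0) -intr_norm -abszE.
have m1 : 1 <= `|m|%N%:R :> R by rewrite ler1n absz_gt0.
have mnR : `|m|%N%:R <= n%:R :> R by rewrite ler_nat.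
have QnR : 4 * (n%:R + 1) <= Q%:R :> R.
  by rewrite natr1 -natrM ler_nat.
rewrite -pmulrn; apply/andP; split.
  by apply: (le_trans geo_lo); rewrite ler_peMr.
apply: (@le_trans _ _ (2 / Q%:R * n%:R)).
  by apply: ler_pM.
rewrite mulrAC ler_pdivrMr//; lra.
Qed.

End Block.

(** * Ladders: sequences on which characters take values cis (p ^- k) *)

Lemma cvg_big_sum (R : realType) I (r : seq I) (f : I -> nat -> R) (l : I -> R) :
  (forall i, f i n @[n --> \oo] --> l i) ->
  \sum_(i <- r) f i n @[n --> \oo] --> \sum_(i <- r) l i.
Proof.
move=> fl; elim: r => [|i r IH].
  by rewrite big_nil; under eq_fun do rewrite big_nil; exact: cvg_cst.
by rewrite big_cons; under eq_fun do rewrite big_cons; exact: cvgD.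
Qed.

Section LadderCriterion.
Variables (R : realType) (p : nat) (G : zmodType) (e : G) (b : nat -> G).
Variables (chi : nat -> G -> R[i]) (up : bool).
Hypothesis p_gt1 : (1 < p)%N.
Hypothesis chiP : forall l, character (chi l).

(* The direction in which levels see the sequence: all i below l if up (as for
   b i = 2 ^ i x), all i above l otherwise (as in a Pruefer group). The truncated
   subtraction is meant, since cis (p ^- 0) = cis 1 = 1. *)
Let depth (i l : nat) := if up then (l - i)%N else (i - l)%N.

Hypothesis chi_b : forall l i, (0 < l)%N ->
  chi l (b i) = cis (p%:R ^- depth i l).
Hypothesis chi_b_cvg : forall l, dist1 (chi l (b i)) @[i --> \oo] --> 0.
Hypothesis chi_e : forall l, (0 < l)%N -> chi l e = 1.
Hypothesis b_decay : forall psi : G -> R[i], character psi ->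
  dist1 (psi (b i)) @[i --> \oo] --> 0 ->
  exists i0, forall i, (i0 <= i)%N -> 3 / 2 * dist1 (psi (b i.+1)) <= dist1 (psi (b i)).

(* The n-th block has levels and indices in arithmetic progression of difference
   step n, so that consecutive depths scale by ratio n. The number count n of
   levels is chosen after ratio n, to compensate for the small gap. *)
Let step n := n.+2.

Let ratio n := (p ^ step n)%N.

Let ratio_ge n : (4 * n.+1 <= ratio n)%N.
Proof.
apply: (@leq_trans (2 ^ step n)); last by rewrite leq_exp2r.
by rewrite /step !expnS mulnA leq_mul2l ltn_expl.
Qed.

Let gap n : R := dist1 (cis ((ratio n)%:R^-1 : R)).

Let gap_gt0 n : 0 < gap n.
Proof.
have rn : (1 < ratio n)%N by apply: leq_trans (ratio_ge n); lia.
apply: dist1_cis_gt0; rewrite invr_gt0 ltr0n (ltnW rn)/=.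
by rewrite invf_lt1 ?ltr0n ?ltr1n// ltnW.
Qed.

Let count n := (Num.trunc (n.+1%:R / gap n)).+1.

Let count_gap n : n.+1%:R <= gap n *+ count n.
Proof.
rewrite -[gap n *+ _]mulr_natl -ler_pdivrMr//; exact/ltW/truncnS_gt.
Qed.

Fixpoint start n := if n is m.+1 then (start m + count m * step m)%N else 1%N.

Let start_gt0 n : (0 < start n)%N.
Proof. by elim: n => //= n IH; rewrite ltn_addr. Qed.

Let start_mono n k : (n < k)%N -> (start n.+1 <= start k)%N.
Proof.
elim: k => // k IH; rewrite ltnS leq_eqVlt => /orP[/eqP ->//|/IH H].
by apply: (leq_trans H); rewrite /= leq_addr.
Qed.

Let start_ge n : (n < start n)%N.
Proof. by elim: n => //= n IH; rewrite -addn1 leq_add// muln_gt0. Qed.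

Let pos n j := (start n + j * step n)%N.

(* Indices and levels run through the same progression, shifted by one place.
   They are enumerated in the order that makes depth_block the same in both directions. *)
Let index n j := pos n (if up then (count n - j.+1)%N else j.+1).

Let level n a := pos n (if up then (count n - a)%N else a).

Let pos_le n j : (j <= count n)%N -> (start n <= pos n j <= start n.+1)%N.
Proof. by move=> jn; rewrite leq_addr /= leq_add2l leq_mul2r jn orbT. Qed.

Let pos_inj n : injective (pos n).
Proof.
by move=> j k /addnI/eqP; rewrite eqn_mul2r => /orP[//|/eqP].
Qed.

Let index_bounds n j : (j < count n)%N ->
  (start n <= index n j <= start n.+1)%N.
Proof. by move=> jn; apply: pos_le; case: up => //; exact: leq_subr. Qed.

Let level_bounds n a : (a < count n)%N ->
  (start n <= level n a <= start n.+1)%N.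
Proof. by move=> an; apply: pos_le; case: up; [exact: leq_subr|exact: ltnW]. Qed.

Let index_inj n : {in [pred j | (j < count n)%N] &, injective (index n)}.
Proof.
by move=> j k; rewrite !inE => jn kn /pos_inj; case: up; lia.
Qed.

Let level_inj n : {in [pred a | (a < count n)%N] &, injective (level n)}.
Proof.
by move=> j k; rewrite !inE => jn kn /pos_inj; case: up; lia.
Qed.

Let depth_block n a j : (a < count n)%N -> (j < count n)%N ->
  depth (index n j) (level n a) = (step n * (j.+1 - a))%N.
Proof.
move=> an jn; rewrite /depth /index /level /pos.
case: up; rewrite subnDl -mulnBl mulnC; last by [].
by congr muln; lia.
Qed.

Definition ladder_sum n : G := \sum_(j < count n) b (index n j).

Definition ladder_seminorm n (x : G) : R :=
  \sum_(a < count n) dist1 (chi (level n a) x).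

Let level_gt0 n a : (0 < level n a)%N.
Proof. by rewrite /level /pos ltn_addr. Qed.

Let seminorm_dist1 l : seminorm (fun x => dist1 (chi l x)).
Proof.
split=> [|x y]; first by rewrite (char0 (chiP l)) dist1_1.
exact: dist1_charB.
Qed.

Let sD n : seminorm (ladder_seminorm n).
Proof. exact: seminorm_sum. Qed.

Let ladder_bounded n i : ladder_seminorm n (b i) <= 6 * pi.
Proof.
rewrite /ladder_seminorm; under eq_bigr do rewrite chi_b//.
apply: (dist1_cis_sum R (t := fun a : 'I_(count n) => depth i (level n a)) p_gt1).
move=> a a'; rewrite !inE => a0 a'0 aa'.
apply/ord_inj/(@level_inj n); [exact: ltn_ord|exact: ltn_ord|].
by move: a0 a'0 aa'; rewrite /depth; case: up; lia.
Qed.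

Let ladder_cvg n : ladder_seminorm n (b i) @[i --> \oo] --> 0.
Proof.
rewrite -[0](@big1 R 0 +%R _ (index_enum 'I_(count n)) xpredT (fun=> 0))//.
by apply: cvg_big_sum => a; exact: chi_b_cvg.
Qed.

Let ladder_block n (m : int) : (`|m| <= n)%N ->
  (e *~ m = 0 /\ ladder_sum n *~ m = 0) \/
  n.+1%:R <= ladder_seminorm n (ladder_sum n *~ m).
Proof.
move=> mn; have [->|m0] := eqVneq m 0; first by left; rewrite !mulr0z.
right; apply: (le_trans (count_gap n)).
apply: (block_lower_bound (ratio_ge n) (psi := fun a => chi (level n a))
  (y := fun j => b (index n j))) => //.
move=> a j an jn; rewrite chi_b// depth_block//.
by rewrite natrX exprM.
Qed.

Let triangular :
  (forall n k, (n < k)%N -> ladder_seminorm n (ladder_sum k) = 0) \/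
  (forall n k, (k < n)%N -> ladder_seminorm n (ladder_sum k) = 0).
Proof.
have zero n k : (forall a j, (a < count n)%N -> (j < count k)%N ->
    depth (index k j) (level n a) = 0%N) ->
    ladder_seminorm n (ladder_sum k) = 0.
  move=> d0; apply: big1 => a _; rewrite (char_sum (chiP _)) big1 ?dist1_1// => j _.
  by rewrite chi_b// d0// expr0 invr1 (cis_int R 1).
case: (boolP up) => upP; [left|right] => n k nk; apply: zero => a j an jk;
  have := index_bounds jk; have := level_bounds an; have := start_mono nk;
  rewrite /depth ?upP ?(negPf upP); lia.
Qed.

(** The decay of the distances along b makes the sum over a block comparable to
    its first term. *)
Let b_to_c (psi : G -> R[i]) : character psi ->
  dist1 (psi (b i)) @[i --> \oo] --> 0 -> dist1 (psi (ladder_sum i)) @[i --> \oo] --> 0.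
Proof.
move=> psiP psib; have [i0 decay] := b_decay psiP psib.
apply/cvgr0Pnorm_lt => eps eps0.
have /cvgr0Pnorm_lt/(_ (eps / 3)) := psib; rewrite divr_gt0// => /(_ isT)[N _ NP].
exists (maxn i0 N) => // n /=; rewrite geq_max => /andP[i0n Nn].
rewrite ger0_norm ?dist1_ge0// (char_sum psiP).
rewrite (le_lt_trans (dist1_prod _ _ (fun j => char_norm psiP _)))//.
pose F i := dist1 (psi (b i)).
apply: (@le_lt_trans _ _ (\sum_(start n <= i < (start n.+1).+1) F i)).
  apply: (@sum_inj_le R F (count n) xpredT (fun j : 'I_ _ => index n j)).
  - by move=> i; exact: dist1_ge0.
  - move=> j k _ _ jk; apply/ord_inj/(@index_inj n) => //; exact: ltn_ord.
  - by move=> j _; rewrite ltnS index_bounds.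
have sn : (n <= start n)%N by exact: ltnW.
apply: (@le_lt_trans _ _ (3 * F (start n))).
  apply: sum_geometric_decay => [i|i si]; first exact: dist1_ge0.
  by apply: decay; apply: leq_trans si; exact: leq_trans sn.
rewrite mulrC -ltr_pdivlMr// -[F _]ger0_norm ?dist1_ge0//; apply: NP => /=.
exact: leq_trans sn.
Qed.

(** Only the behaviour of b itself remains to be checked: the choice of the blocks
    takes care of c and D. *)
Lemma almost_map_ladder (E : G -> R) (delta : R) (N : nat) :
  e != 0 -> (0 < N)%N -> e *+ N = 0 ->
  seminorm E -> E (b i) @[i --> \oo] --> 0 -> 0 < delta ->
  (forall j : int, E (e *~ j) < delta -> e *~ j = 0) ->
  (forall g, (forall j : int, g <> e *~ j) -> exists psi : G -> R[i],
     [/\ character psi, psi e = 1, dist1 (psi (b i)) @[i --> \oo] --> 0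
       & psi g != 1]) ->
  exists u : nat -> G,
    T_sequence u /\ almost_maximally_almost_periodic R (finest_space u).
Proof.
move=> e0 N0 eN sE Eb delta0 Esep sep.
apply: (@almost_map_criterion R G e b ladder_sum ladder_seminorm E (6 * pi)
  delta sD sE ladder_bounded ladder_cvg Eb delta0 Esep _ ladder_block
  triangular N) => //.
by move=> n; apply: big1 => a _; rewrite chi_e// dist1_1.
Qed.

End LadderCriterion.

(** * Elements of infinite order and Pruefer groups *)

(** If chi (2 ^ i x) tends to 1, then chi (2 ^ i x) = 1 for large i, because the
    circle has no small subgroups. The characters with chi x = cis (2 ^- l) and
    chi e = 1 do the separation. *)
Lemma almost_map_infinite_order (R : realType) (G : zmodType) (x e : G) N :
  (forall n, (0 < n)%N -> x *+ n <> 0) -> e != 0 -> (0 < N)%N -> e *+ N = 0 ->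
  exists u : nat -> G,
    T_sequence u /\ almost_maximally_almost_periodic R (finest_space u).
Proof.
move=> x_inf e0 N0 eN.
have x_free a : x *~ a = 0 -> a = 0.
  have [->//|a0] := eqVneq a 0; move=> xa; exfalso.
  apply: (x_inf `|a|%N); first by rewrite absz_gt0.
  by case: a xa a0 => n; rewrite ?NegzE ?mulrNz => /eqP; rewrite ?oppr_eq0 => /eqP.
have direct a j : x *~ a + e *~ j = 0 -> a = 0.
  move=> /(congr1 (fun y => y *+ N)); rewrite mul0rn mulrnDl !pmulrn.
  rewrite -[e *~ j *~ N]mulrzA -[e *~ _]mulrzA_C -[e *~ N]pmulrn eN mul0rz addr0.
  rewrite -mulrzA => /x_free/eqP; rewrite mulf_eq0 eqz_nat => /orP[/eqP//|].
  by rewrite gtn_eqF.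
have pow_gt0 l : 0 < 2 ^+ l :> R by rewrite exprn_gt0.
have ex_chi l : exists chi : G -> R[i], character chi /\
    forall a j, chi (x *~ a + e *~ j) = cis (a%:~R / 2 ^+ l).
  pose Gam : set (G * R[i]) := [set q | exists a j : int,
    q = (x *~ a + e *~ j, cis (a%:~R / 2 ^+ l))].
  have pG : partial_character Gam.
    split.
    - by exists 0, 0; rewrite !mulr0z addr0 mul0r cis0.
    - move=> _ _ _ _ [a [j [-> ->]]] [a' [j' [-> ->]]]; exists (a - a'), (j - j').
      by rewrite !mulrzBr opprD addrACA -cisN -cisD mulrBl.
    - by move=> _ _ [a [j [_ ->]]]; exact: cis_norm.
    - by move=> z [a [j [/esym/direct -> ->]]]; rewrite mul0r cis0.
  have [chi chiP chiE] := partial_char_extend pG.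
  by exists chi; split=> // a j; apply: chiE; exists a, j.
have [chi chiP] := choice ex_chi.
pose b i := x *+ 2 ^ i.
have chi_b l i : chi l (b i) = cis (2%:R ^- (l - i)).
  have -> : b i = x *~ (2 ^ i)%N + e *~ 0 by rewrite mulr0z addr0 -pmulrn.
  rewrite (chiP l).2 -pmulrn natrX; have [il|li] := leqP i l.
    congr cis; have -> : 2 ^+ l = 2 ^+ (l - i) * 2 ^+ i :> R.
      by rewrite -exprD subnK.
    by field; rewrite !expf_neq0.
  have -> : (l - i = 0)%N by lia.
  have -> : 2 ^+ i / 2 ^+ l = (2 ^ (i - l))%N%:~R :> R.
    rewrite -{1}(subnK (ltnW li)) exprD mulfK ?expf_neq0//.
    by rewrite -pmulrn natrX.
  by rewrite expr0 invr1 cis_int (cis_int R 1).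
have chi_b_cvg l : dist1 (chi l (b i)) @[i --> \oo] --> 0.
  apply/cvgr0Pnorm_lt => eps eps0; exists l => // i /= li.
  rewrite chi_b; have -> : (l - i = 0)%N by lia.
  by rewrite expr0 invr1 (cis_int R 1) dist1_1 normr0.
have chi_e l : chi l e = 1.
  have -> : e = x *~ 0 + e *~ 1 by rewrite mulr0z add0r.
  by rewrite (chiP l).2 mul0r cis0.
have sX : subgroup [set y | exists a, y = x *~ a].
  split=> [|_ _ [a ->] [a' ->]]; first by exists 0; rewrite mulr0z.
  by exists (a - a'); rewrite mulrzBr.
apply: (@almost_map_ladder R 2 G e b chi true isT (fun l => (chiP l).1)
  (fun l i _ => chi_b l i) chi_b_cvg (fun l _ => chi_e l) _
  (fun y => `[< ~ [set y | exists a, y = x *~ a] y >]%:R) 1 N) => //.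
- move=> psi psiP /cvgr0Pnorm_lt/(_ 8^-1); rewrite invr_gt0 => /(_ (ltr0n _ 8)).
  move=> [i0 _ Hi0]; exists i0.
  suff one i : (i0 <= i)%N -> psi (b i) = 1.
    by move=> i i0i; rewrite !one ?dist1_1 ?mulr0// leqW.
  move=> i0i; apply: no_small_subgroups => [|j]; first exact: char_norm.
  rewrite -(charMn psiP) -mulrnA -expnD ltW//.
  have := Hi0 (i + j)%N; rewrite /= ger0_norm ?dist1_ge0//; apply.
  by rewrite (leq_trans i0i)// leq_addr.
- exact: seminorm_outside.
- rewrite (_ : (fun i => _) = fun=> 0); first exact: cvg_cst.
  by apply/funext => i; rewrite asboolF//; apply; exists (2 ^ i)%N; rewrite -pmulrn.
- move=> j; case: asboolP; first by rewrite ltxx.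
  move=> /contrapT[a ea] _; rewrite ea (direct a (- j)) ?mulr0z//.
  by rewrite mulrNz ea subrr.
- move=> g ng; pose K := [set y | exists a j : int, y = x *~ a + e *~ j].
  have sK : subgroup K.
    split=> [|_ _ [a [j ->]] [a' [j' ->]]]; first by exists 0, 0; rewrite !mulr0z addr0.
    by exists (a - a'), (j - j'); rewrite !mulrzBr opprD addrACA.
  have [[a [j gE]]|nK] := pselect (K g).
    exists (chi `|a|%N); split=> //; first exact: (chiP _).1.
    rewrite gE (chiP _).2; apply/eqP; rewrite -natrX => /cis_eq1_dvd.
    rewrite expn_gt0 => /(_ isT); rewrite dvdzE /=.
    have [a0|a0] := eqVneq a 0.
      by move=> _; apply: (ng j); rewrite gE a0 mulr0z add0r.
    move/dvdn_leq; rewrite absz_gt0 => /(_ a0).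
    by rewrite leqNgt ltn_expl.
  have [psi [psiP psiK psig]] := @character_separates R G K g sK nK.
  exists psi; split=> //; first by apply: psiK; exists 0, 1; rewrite mulr0z add0r.
  apply/cvgr0Pnorm_lt => eps eps0; exists 0%N => // i _ /=.
  rewrite psiK ?dist1_1 ?normr0//; exists (2 ^ i)%N, 0.
  by rewrite mulr0z addr0 -pmulrn.
Qed.

Section Prufer.
Variables (R : realType) (G : zmodType) (x : nat -> G) (p : nat).
Hypothesis p_prime : prime p.
Hypothesis x0 : x 0 = 0.
Hypothesis x1 : x 1 != 0.
Hypothesis xp : forall i, x i.+1 *+ p = x i.

Let p_gt1 : (1 < p)%N. Proof. exact: prime_gt1. Qed.

Let pow_gt0 i : 0 < p%:R ^+ i :> R.
Proof. by rewrite exprn_gt0// ltr0n prime_gt0. Qed.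

Let x_pow i l : x i *+ p ^ l = x (i - l).
Proof.
elim: l i => [|l IH] i; first by rewrite mulr1n subn0.
rewrite expnS mulrnA; case: i => [|i]; last by rewrite xp IH.
by rewrite x0 !mul0rn -x0.
Qed.

Let x_dvd i (a : int) : x i *~ a = 0 -> ((p ^ i)%N %| a)%Z.
Proof.
elim: i a => [|i IH] a xa; first by rewrite dvd1z.
have /IH/dvdzP[q aE] : x i *~ a = 0.
  by rewrite -xp pmulrn mulrzAC xa mul0rz.
have xq : x 1 *~ q = 0.
  have -> : x 1 = x i.+1 *~ (p ^ i)%N by rewrite -pmulrn x_pow subSnn.
  by rewrite -mulrzA mulrC -aE.
have [pq|pq] := boolP (p %| q)%Z.
  by rewrite aE expnS PoszM dvdz_mul.
have x1p : x 1 *+ p = 0 by rewrite xp.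
have [k x1E] := prime_order_gen p_prime x1p pq.
by move: x1; rewrite x1E xq mul0rz eqxx.
Qed.

Let Gam : set (G * R[i]) :=
  [set q | exists i (a : int), q = (x i *~ a, cis (a%:~R / p%:R ^+ i))].

Let Gam_pchar : partial_character Gam.
Proof.
split.
- by exists 0%N, 0; rewrite mulr0z mul0r cis0.
- move=> _ _ _ _ [i [a [-> ->]]] [j [a' [-> ->]]].
  exists (i + j)%N, (a * (p ^ j)%N - a' * (p ^ i)%N); congr (_, _).
    have -> : x i = x (i + j) *~ (p ^ j)%N by rewrite -pmulrn x_pow addnK.
    have -> : x j = x (i + j) *~ (p ^ i)%N by rewrite -pmulrn x_pow addKn.
    by rewrite mulrzBr -!mulrzA ![Posz _ * _]mulrC.
  rewrite -cisN -cisD; congr cis; rewrite intrB !intrM -!pmulrn !natrX exprD.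
  by field; rewrite !expf_neq0// pnatr_eq0 -lt0n prime_gt0.
- by move=> _ _ [i [a [_ ->]]]; exact: cis_norm.
- move=> z [i [a [/esym/x_dvd/dvdzP[q ->] ->]]].
  rewrite intrM -pmulrn natrX mulfK ?cis_int//.
  by rewrite expf_neq0// pnatr_eq0 -lt0n prime_gt0.
Qed.

(** The characters chi l = chi0 (p ^ l -) kill x 1 for l > 0, and chi 1 kills only
    the multiples of x 1 within the Pruefer group. The generator e = x 1 belongs
    to the group on which the x i tend to 0, so E has to be a distance: it
    separates the p - 1 nonzero multiples of x 1 from 0. *)
Lemma almost_map_prufer : exists u : nat -> G,
  T_sequence u /\ almost_maximally_almost_periodic R (finest_space u).
Proof.
have [chi0 chi0P chi0G] := partial_char_extend Gam_pchar.
have chi0E i a : chi0 (x i *~ a) = cis (a%:~R / p%:R ^+ i).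
  by apply: chi0G; exists i, a.
pose chi l y := chi0 (y *+ p ^ l).
have chiP l : character (chi l).
  by split=> [y|y z]; rewrite /chi ?mulrnDl ?(charD chi0P)// (char_norm chi0P).
have chi_x l i : chi l (x i) = cis (p%:R ^- (i - l)).
  by rewrite /chi x_pow -[x _]mulr1z chi0E mul1r.
have chi_cvg l : dist1 (chi l (x i)) @[i --> \oo] --> 0.
  under eq_fun do rewrite chi_x.
  have pow_cvg : dist1 (cis (p%:R ^- k : R)) @[k --> \oo] --> 0.
    have geo : 2 * pi * p%:R^-1 ^+ k @[k --> \oo] --> (0 : R).
      rewrite -[0](mulr0 (2 * pi)); apply: cvgM; first exact: cvg_cst.
      apply: cvg_expr; rewrite ger0_norm ?invr_ge0// invf_lt1 ?ltr1n//.
      by rewrite ltr0n ltnW.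
    apply: (squeeze_cvgr _ (cvg_cst 0) geo); near=> k.
    rewrite dist1_ge0 /= (le_trans (dist1_cis_le _))//.
    by rewrite ger0_norm ?exprVn// invr_ge0 exprn_ge0.
  exact: (cvg_comp _ _ (@cvg_subnr l) pow_cvg).
have x1p : x 1 *+ p = 0 by rewrite xp x0.
apply: (@almost_map_ladder R p G (x 1) x chi false p_gt1 chiP
  (fun l i _ => chi_x l i) chi_cvg _ _
  (fun y => dist1 (chi 0%N y)) (dist1 (cis (p%:R^-1 : R)) / p%:R) p) => //.
- move=> l l0; rewrite chi_x; have -> : (1 - l = 0)%N by lia.
  by rewrite expr0 invr1 (cis_int R 1).
- move=> psi psiP /cvgr0Pnorm_lt/(_ (2^-1 / (p ^ 2)%:R)).
  rewrite divr_gt0 ?ltr0n ?expn_gt0 ?prime_gt0// => /(_ isT)[i0 _ Hi0].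
  exists i0 => i i0i; rewrite -[x i]xp (charMn psiP); apply: dist1_expand => //.
    exact: char_norm.
  rewrite -ler_pdivlMr ?ltr0n ?expn_gt0 ?prime_gt0// ltW//.
  by have := Hi0 i.+1; rewrite /= ger0_norm ?dist1_ge0//; apply; exact: leqW.
- exact: prime_gt0.
- split=> [|y z]; first by rewrite (char0 (chiP 0%N)) dist1_1.
  exact: dist1_charB.
- rewrite divr_gt0 ?ltr0n ?prime_gt0//; apply: dist1_cis_gt0.
  by rewrite invr_gt0 ltr0n prime_gt0//= invf_lt1 ?ltr0n ?ltr1n ?prime_gt0.
- move=> j small; have [pj|pj] := boolP (p %| j)%Z.
    exact: torsion_dvd x1p pj.
  (* x 1 is i times x 1 j with i < p, so that its distance to 0 is at most p
     times that of x 1 j. *)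
  have [k x1E] := prime_order_gen p_prime x1p pj; exfalso.
  have xjp : x 1 *~ j *+ p = 0 by rewrite pmulrn mulrzAC -pmulrn x1p mul0rz.
  have [i ip xjE] := torsion_mulrz k (prime_gt0 p_prime) xjp.
  move: small; apply/negP; rewrite -leNgt ler_pdivrMr ?ltr0n ?prime_gt0//.
  have -> : cis (p%:R^-1) = chi 0%N (x 1) by rewrite chi_x subn0 expr1.
  rewrite {1}x1E xjE (charMn (chiP 0%N)) mulr_natr.
  rewrite (le_trans (dist1X _ (char_norm (chiP 0%N) _)))//.
  by rewrite ler_wpMn2l ?dist1_ge0// ltnW.
- move=> g ng; pose K := [set y | exists i (a : int), y = x i *~ a].
  have sK : subgroup K.
    have [G0 GB _ _] := Gam_pchar; split.
      by case: G0 => i [a [yE _]]; exists i, a.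
    move=> y z [i [a yE]] [j [a' zE]].
    have Gy : Gam (y, cis (a%:~R / p%:R ^+ i)) by exists i, a; rewrite yE.
    have Gz : Gam (z, cis (a'%:~R / p%:R ^+ j)) by exists j, a'; rewrite zE.
    by have [k [c [yzE _]]] := GB _ _ _ _ Gy Gz; exists k, c.
  have [[i [a gE]]|nK] := pselect (K g).
    exists (chi 1%N); split=> //; first by rewrite chi_x subnn expr0 invr1 (cis_int R 1).
    apply/eqP; rewrite /chi expn1 gE.
    case: i gE => [|k] gE.
      by move=> _; apply: (ng 0); rewrite gE x0 mul0rz mulr0z.
    rewrite pmulrn mulrzAC -pmulrn xp chi0E -natrX => /cis_eq1_dvd.
    rewrite expn_gt0 prime_gt0// => /(_ isT)/dvdzP[q aE].
    apply: (ng q); have -> : x 1 = x k.+1 *~ (p ^ k)%N.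
      by rewrite -pmulrn x_pow subSnn.
    by rewrite gE aE -mulrzA mulrC.
  have [psi [psiP psiK psig]] := @character_separates R G K g sK nK.
  exists psi; split=> //.
    by apply: psiK; exists 1%N, 1.
  apply/cvgr0Pnorm_lt => eps eps0; exists 0%N => // i _ /=.
  by rewrite psiK ?dist1_1 ?normr0//; exists i, 1.
Unshelve. all: by end_near.
Qed.

End Prufer.

(** * Finding one of the three configurations in G *)

Lemma infinite_avoid (T : Type) (A K : set T) :
  infinite_set A -> finite_set K -> exists2 x, A x & ~ K x.
Proof.
move=> infA finK; apply: contrapT => H; apply: infA.
apply: sub_finite_set finK => x Ax; apply: contrapT => Kx.
by apply: H; exists x.
Qed.

(** The span of finitely many torsion elements is finite, so an infinite supply of
    candidates always contains one outside of it. *)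
Lemma exists_free_sequence (G : zmodType) (Q : nat -> nat -> Prop) :
  (forall n, infinite_set [set x : G | exists q, [/\ prime q, Q n q & x *+ q = 0]]) ->
  exists (e : nat -> G) (p : nat -> nat), forall n,
    [/\ prime (p n), Q n (p n), e n *+ p n = 0
      & ~ span_of (fun i => (i < n)%N) e (e n)].
Proof.
move=> infQ.
have /choice[f fP] : forall nK : nat * set G, exists xq : G * nat,
    finite_set nK.2 -> [/\ prime xq.2, Q nK.1 xq.2, xq.1 *+ xq.2 = 0 & ~ nK.2 xq.1].
  move=> [n K]; have [finK|nK] := pselect (finite_set K); last by exists (0, 0%N).
  have [x [q [pq Qq xq]] Kx] := infinite_avoid (infQ n) finK.
  by exists (x, q).
pose add (K : set G) (x : G) : set G :=
  [set z | exists y (a : int), K y /\ z = y + x *~ a].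
pose K := fix K n := if n is m.+1 then add (K m) (f (m, K m)).1 else [set 0].
pose e n := (f (n, K n)).1; pose p n := (f (n, K n)).2.
have finK n : finite_set (K n).
  elim: n => [|n IH]; first exact: finite_set1.
  have [pp _ ep _] := fP (n, K n) IH.
  apply: (@sub_finite_set _ _ ((fun yi => yi.1 + e n *+ yi.2) @` (K n `*` `I_(p n)))).
    move=> _ [y [a [Ky ->]]].
    have [i ip ->] := torsion_mulrz a (prime_gt0 pp) ep.
    by exists (y, i).
  by apply: finite_image; apply: finite_setX => //; exact: finite_II.
have sK n : subgroup (K n).
  elim: n => [|n IH].
    by split=> [//|x y /= -> ->]; rewrite subr0.
  split=> [|_ _ [y [a [Ky ->]]] [y' [a' [Ky' ->]]]].
    by exists 0, 0; rewrite mulr0z addr0; split=> //; case: IH.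
  exists (y - y'), (a - a'); split; first exact: IH.2.
  by rewrite mulrzBr opprD addrACA.
have Ksub n x : K n x -> K n.+1 x.
  by move=> Kx; exists x, 0; rewrite mulr0z addr0.
have Ke n i : (i < n)%N -> K n (e i).
  elim: n => // n IH; rewrite ltnS leq_eqVlt => /orP[/eqP ->|/IH/Ksub//].
  by exists 0, 1; rewrite add0r; split=> //; case: (sK n).
exists e, p => n; have [pp Qp ep nKe] := fP (n, K n) (finK n); split=> //.
move=> [N [a [a0 eE]]]; apply: nKe => /=; rewrite -/(e n) eE.
have KF (i : 'I_N) : xpredT i -> K n (e i *~ a i).
  move=> _; have [ni|ni] := ltnP i n.
    by apply: subgroupMz => //; exact: Ke.
  by rewrite a0 ?mulr0z -?leqNgt ?ni//; case: (sK n).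
exact: (subgroup_sum (index_enum 'I_N) (sK n) KF).
Qed.

Definition prime_torsion (G : zmodType) : set G :=
  [set x | exists2 q, prime q & x *+ q = 0].

(** Either one prime q has infinitely many elements killed by it, and all orders
    can be taken equal to q, or infinitely many primes occur, and the orders can
    be taken as large as needed. *)
Lemma almost_map_infinite_socle (R : realType) (G : zmodType) :
  infinite_set (@prime_torsion G) ->
  exists u : nat -> G,
    T_sequence u /\ almost_maximally_almost_periodic R (finest_space u).
Proof.
move=> infS.
have [[q pq infq]|fin] :=
    pselect (exists2 q, prime q & infinite_set [set x : G | x *+ q = 0]).
  have [n|e [p H]] := @exists_free_sequence G (fun _ q' => q' = q).
    apply: contra_not infq; apply: sub_finite_set => x /= xq.
    by exists q.
  apply: (@almost_map_direct_sum R G e p); try by move=> n; case: (H n).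
  by left=> n; have [_ -> _ _] := H n; have [_ -> _ _] := H 0%N.
have {}fin q : prime q -> finite_set [set x : G | x *+ q = 0].
  by move=> pq; apply: contrapT => infq; apply: fin; exists q.
have [n|e [p H]] := @exists_free_sequence G (fun n q => (n < q)%N).
  apply: contra_not infS => finn.
  apply: (@sub_finite_set _ _
    ([set x : G | exists q, [/\ prime q, (n < q)%N & x *+ q = 0]] `|`
    \bigcup_(q in `I_n.+1) [set x : G | prime q /\ x *+ q = 0])).
    move=> x [q pq xq]; have [nq|qn] := ltnP n q; first by left; exists q.
    by right; exists q.
  rewrite finite_setU; split=> //; apply: bigcup_finite; first exact: finite_II.
  move=> q _; have [pq|npq] := boolP (prime q).
    by apply: sub_finite_set (fin q pq) => x [].
  by apply: (@sub_finite_set _ _ set0) => // x [].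
apply: (@almost_map_direct_sum R G e p); try by move=> n; case: (H n).
by right=> n; case: (H n).
Qed.

(** Compactness of a finite set. *)
Lemma pigeonhole (T : choiceType) (A : set T) (P : nat -> set T) :
  finite_set A -> (forall m n, (m <= n)%N -> P n `<=` P m) ->
  (forall n, exists2 a, A a & P n a) -> exists2 a, A a & forall n, P n a.
Proof.
move=> /finite_seqP[s ->] Pdecr hit; apply: contrapT => H.
have /choice[f fP] : forall a, exists n, a \in s -> ~ P n a.
  move=> a; have [as_|nas] := boolP (a \in s); last by exists 0%N.
  apply: contrapT => Ha; apply: H; exists a => // n.
  by apply: contrapT => nP; apply: Ha; exists n.
have [a /= as_ Pa] := hit (\max_(a <- s) f a).
apply: (fP a as_); apply: Pdecr Pa.
exact: leq_bigmax_seq.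
Qed.

Lemma finite_fiber (G : zmodType) q (y : G) :
  finite_set [set x : G | x *+ q = 0] -> finite_set [set x : G | x *+ q = y].
Proof.
move=> fin; have [[x0 x0q]|nx] := pselect (exists x0, x0 *+ q = y); last first.
  by apply: (@sub_finite_set _ _ set0) => // x xq; apply: nx; exists x.
apply: sub_finite_set (finite_image (fun z => x0 + z) fin) => x /= xq.
exists (x - x0); first by rewrite /= mulrnBl xq x0q subrr.
by rewrite addrC subrK.
Qed.

Section FiniteSocle.
Variable G : zmodType.
Hypothesis infG : infinite_set [set: G].
Hypothesis torsG : forall x : G, exists2 n, (0 < n)%N & x *+ n = 0.
Hypothesis finS : finite_set (@prime_torsion G).

Let fin_prime q : prime q -> finite_set [set x : G | x *+ q = 0].
Proof. by move=> pq; apply: sub_finite_set finS => x xq; exists q. Qed.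

Let fin_torsion k : (0 < k)%N -> finite_set [set x : G | x *+ k = 0].
Proof.
elim/ltn_ind: k => k IH k0; have [k1|k1] := leqP k 1.
  have -> : k = 1%N by lia.
  by apply: sub_finite_set (finite_set1 0) => x /=; rewrite mulr1n.
have pq := pdiv_prime k1; set q := pdiv k in pq.
have kE : (k = k %/ q * q)%N by rewrite divnK// pdiv_dvd.
have m0 : (0 < k %/ q)%N by rewrite divn_gt0 ?prime_gt0// dvdn_leq// pdiv_dvd.
have mk : (k %/ q < k)%N by rewrite ltn_Pdiv// prime_gt1.
apply: (@sub_finite_set _ _ (\bigcup_(y in [set y : G | y *+ (k %/ q) = 0])
    [set x | x *+ q = y])).
  by move=> x /= xk; exists (x *+ q) => //=; rewrite -mulrnA mulnC -kE.
by apply: bigcup_finite; [exact: IH|move=> y _; exact/finite_fiber/fin_prime].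
Qed.

(** G is not killed by n!, because the n!-torsion is finite; hence n! G contains an
    element of prime order. Finitely many candidates exist for these elements,
    so one of them works for all n. *)
Let exists_divisible : exists (x : G) q,
  [/\ prime q, x != 0, x *+ q = 0 & forall n, exists z, x = z *+ q ^ n].
Proof.
have [|||x [[q pq xq] x0] xdiv] := @pigeonhole G (@prime_torsion G `&` [set x | x != 0])
    (fun n => [set x | exists z, x = z *+ n`!]).
- exact: finite_setIl.
- move=> m n mn x [z ->]; have /dvdnP[k ->] : (m`! %| n`!)%N
    by rewrite -(ffact_fact (leq_subr m n)) subKn// dvdn_mull.
  by exists (z *+ k); rewrite -mulrnA.
- move=> n; have [z zn] : exists z : G, z *+ n`! != 0.
    apply: contrapT => /forallNP H; apply: infG.
    apply: sub_finite_set (fin_torsion (fact_gt0 n)) => z _ /=.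
    by have /negP := H z; rewrite negbK => /eqP.
  pose y := z *+ n`!.
  have ex_ord : exists d, (0 < d)%N && (y *+ d == 0).
    by have [d d0 yd] := torsG y; exists d; rewrite d0 yd eqxx.
  have := ex_minnP ex_ord; case=> d /andP[d0 /eqP yd] dmin.
  have d1 : (1 < d)%N.
    by case: d d0 yd {dmin} => [//|[|//]] _; rewrite mulr1n => /eqP; rewrite (negPf zn).
  have pq := pdiv_prime d1; set q := pdiv d in pq.
  have dE : (d = d %/ q * q)%N by rewrite divnK// pdiv_dvd.
  have m0 : (0 < d %/ q)%N by rewrite divn_gt0 ?prime_gt0// dvdn_leq// pdiv_dvd.
  exists (y *+ (d %/ q)); last by exists (z *+ (d %/ q)); rewrite /y -!mulrnA mulnC.
  split; first by exists q => //; rewrite -mulrnA -dE.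
  apply/negP => yq; have := dmin (d %/ q)%N; rewrite m0 yq => /(_ isT).
  by rewrite leqNgt ltn_Pdiv// prime_gt1.
- exists x, q; split=> // n; have [z xE] := xdiv (q ^ n)%N.
  have /dvdnP[k kE] : (q ^ n %| (q ^ n)`!)%N.
    by apply: dvdn_fact; rewrite expn_gt0 prime_gt0//= leqnn.
  by exists (z *+ k); rewrite xE kE mulrnA.
Qed.

(** A divisible element has finitely many quotients by q, one of which is again
    divisible by all powers of q. *)
Lemma exists_prufer : exists (x : nat -> G) p,
  [/\ prime p, x 0 = 0, x 1 != 0 & forall i, x i.+1 *+ p = x i].
Proof.
have [x1 [q [pq x10 x1q x1div]]] := exists_divisible.
pose V (y : G) := forall n, exists z, y = z *+ q ^ n.
have /choice[f fP] : forall y, exists y', V y -> V y' /\ y' *+ q = y.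
  move=> y; have [Vy|nVy] := pselect (V y); last by exists 0.
  have [|||y' yq Vy'] := @pigeonhole G [set y' | y' *+ q = y]
      (fun n => [set y' | exists z, y' = z *+ q ^ n]).
  - exact/finite_fiber/fin_prime.
  - move=> m n mn _ [z ->]; exists (z *+ q ^ (n - m)).
    by rewrite -mulrnA -expnD subnK.
  - move=> n; have [z yE] := Vy n.+1; exists (z *+ q ^ n); last by exists z.
    by rewrite /= yE -mulrnA -expnSr.
  - by exists y'.
pose x i := if i is j.+1 then iter j f x1 else 0.
have Vx j : V (iter j f x1).
  by elim: j => [|j IH] /=; [exact: x1div|case: (fP _ IH)].
exists x, q; split=> // -[|i]; first by rewrite /x /=.
by rewrite /x /=; case: (fP _ (Vx i)).
Qed.

End FiniteSocle.

Theorem theorem1 (R : realType) (G : zmodType) (infG : infinite_set [set: G]) :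
  (exists u : nat -> G,
     T_sequence u /\ almost_maximally_almost_periodic R (finest_space u)) <->
  (exists H : {pred G},
     [/\ zmod_closed H, finite_set [set` H] & [set` H] <> [set 0]]).
Proof.
split=> [[u [_ [_ rad_neq0 rad_fin]]]|[H [[H0 HB] finH H_neq0]]].
  pose rad := von_neumann_radical R (finest_space u).
  pose H : {pred G} := fun g => `[< rad g >].
  have HE g : (g \in H) = `[< rad g >] by [].
  have radE : [set` H] = rad by apply/seteqP; split=> g /=; rewrite HE => /asboolP.
  exists H; rewrite radE; split=> //; split=> [|g h]; rewrite !HE.
    by apply/asboolP => chi /continuous_character_finest[chiP _]; exact: char0.
  move=> /asboolP radg /asboolP radh; apply/asboolP => chi chiC.
  have [chiP _] := (continuous_character_finest u chi).1 chiC.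
  by rewrite /= (charB chiP) (radg _ chiC) (radh _ chiC) divr1.
have [e eH e0] : exists2 e, e \in H & e != 0.
  apply: contrapT => noe; apply: H_neq0; apply/seteqP; split=> [g /= gH|_ /= ->//].
  by apply/eqP; apply: contrapT => /negP g0; apply: noe; exists g.
have [N N0 eN] : exists2 N, (0 < N)%N & e *+ N = 0.
  apply: contrapT => noN; apply: infinite_nat.
  have -> : [set: nat] = (fun n => e *+ n) @^-1` [set` H].
    apply/seteqP; split=> // n _ /=; elim: n => [|n IH]; first by rewrite mulr0n.
    by rewrite mulrSr -[e in _ + e]opprK HB// -[- e]sub0r HB.
  apply: finite_preimage finH => m n _ _ /=.
  wlog mn : m n / (m <= n)%N.
    by move=> W emn; have [/W|/ltnW/W] := leqP m n; [exact|move=> ->].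
  move=> emn; apply/eqP; rewrite eqn_leq mn leqNgt; apply/negP => lt_mn.
  by apply: noN; exists (n - m)%N; rewrite ?subn_gt0// mulrnBr// emn subrr.
have [[x x_inf]|torsG] :=
    pselect (exists x : G, forall n, (0 < n)%N -> x *+ n <> 0).
  exact: almost_map_infinite_order x_inf e0 N0 eN.
have {}torsG (x : G) : exists2 n, (0 < n)%N & x *+ n = 0.
  apply: contrapT => nx; apply: torsG; exists x => n n0 xn.
  by apply: nx; exists n.
have [finS|infS] := pselect (finite_set (@prime_torsion G)).
  have [x [p [pp x0 x1 xp]]] := exists_prufer infG torsG finS.
  exact: almost_map_prufer pp x0 x1 xp.
exact: almost_map_infinite_socle.
Qed.
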